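(* For all $0\le k\le n$, the generalised Koornwinder polynomials satisfy $$\frac{\partial}{\partial x}H_{n,k}^{(a,b,c,d)}=\sum_{m=n-\deg\rho^2-1}^{n-1}c_{m,k}^{\,x,(n,k)}H_{m,k}^{(a+1,b+1,c+1,d+1)}+\sum_{m=n-3}^{n+\deg\rho^2-3}c_{m,k-2}^{\,x,(n,k)}H_{m,k-2}^{(a+1,b+1,c+1,d+1)}+\sum_{m=n-d_0-2}^{n+d_0-2}c_{m,k-1}^{\,x,(n,k)}H_{m,k-1}^{(a+1,b+1,c+1,d+1)},$$ where $$c_{m,k}^{\,x,(n,k)}=\Big(r_k^{(d+1,c+1)}\,\mathcal T_{(a+1,b+1,c+d+2k+2+\eta)}^{(a+1,b+1,c+d+2k+3)}\,D_\eta(w_R^{(a,b,c+d+2k+1)})\Big)_{[m-k,n-k]},$$ for $k\ge2$, $$c_{m,k-2}^{\,x,(n,k)}=\Big(-s_{k-2}^{(d+1,c+1)}\,\rho^2\big(J(w_R^{(a+1,b+1,c+d+2k-1)})\big)\,D_\eta(w_R^{(a,b,c+d+2k-2-\eta)})\,\big(\mathcal T_{(a,b,c+d+2k-2-\eta)}^{(a,b,c+d+2k+1)}\big)^{-1}$$ $$\quad-\big(k\,s_{k-2}^{(d+1,c+1)}+\delta_{k-2}^{(d+1,c+1)}d_{k-1}^{(d+1,c+1)}\big)\,(\rho\rho')\big(J(w_R^{(a+1,b+1,c+d+2k-1)})\big)\,\mathcal T_{(a,b,c+d+2k-1)}^{(a+1,b+1,c+d+2k-1)}\big(\mathcal T_{(a,b,c+d+2k-1)}^{(a,b,c+d+2k+1)}\big)^{-1}\Big)_{[m-k+2,n-k]},$$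 and, for $k\ge1$, in case (i) $$c_{m,k-1}^{\,x,(n,k)}=\Big(-t_{k-1}^{(d+1,c+1)}\,\rho\big(J(w_R^{(a+1,b+1,c+d+2k+1)})\big)\,D_0(w_R^{(a,b,c+d+2k)})\,\big(\mathcal T_{(a,b,c+d+2k)}^{(a,b,c+d+2k+1)}\big)^{-1}$$ $$\quad-\big(k\,t_{k-1}^{(d+1,c+1)}+\gamma_{k-1}^{(d+1,c+1)}d_{k-1}^{(d+1,c+1)}\big)\,\rho'\big(J(w_R^{(a+1,b+1,c+d+2k+1)})\big)\,\mathcal T_{(a,b,c+d+2k+1)}^{(a+1,b+1,c+d+2k+1)}\Big)_{[m-k+1,n-k]},$$ while in case (ii) $c_{m,k-1}^{\,x,(n,k)}=0$ (the third sum is absent). Therefore the matrix $D_x^{(a,b,c,d)}$, defined by $\frac{\partial}{\partial x}\mathbf H^{(a,b,c,d)}=\mathbf H^{(a+1,b+1,c+1,d+1)}D_x^{(a,b,c,d)}$, has block-bandwidths $(\deg\rho^2-3,\deg\rho^2+1)$ and each block has bandwidths $(0,2)$.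
   Context: Setting. Let $\alpha<\beta$ and $\gamma<\delta$ be real, and let $\rho$ be a function on $[\alpha,\beta]$, positive on $(\alpha,\beta)$, with either: case (i), $\rho$ is a polynomial of degree $d_0$ (so $\deg\rho^2=2d_0$); or case (ii), $\rho$ is the square root of a polynomial of degree $d_1=\deg\rho^2$ and $\delta=-\gamma>0$. Put $\eta=0$ in case (i), $\eta=1$ in case (ii), so $d_\eta=\deg\rho^{1+\eta}$; assume $d_\eta\ge 2+\eta$. Let $\Omega=\{(x,y):\alpha\le x\le\beta,\ \gamma\rho(x)\le y\le\delta\rho(x)\}$. The parameters $a,b,c,d>-1$ are real, with $c=d$ in case (ii), and such that the weights below are integrable. Polynomials. $w_R^{(a,b,s)}(x)=(\beta-x)^a(x-\alpha)^b\rho(x)^s$ on $[\alpha,\beta]$, and $R_n^{(a,b,s)}$ ($n\ge0$) are the orthonormal polynomials (degree $n$, positive leading coefficient) for this weight; $\mathbf R^{(a,b,s)}=(R_0^{(a,b,s)},R_1^{(a,b,s)},\dots)$. $w_P^{(d,c)}(y)=(\delta-y)^d(y-\gamma)^c$ on $[\gamma,\delta]$, with orthonormal polynomials $\widetilde P_n^{(d,c)}$ (shifted normalised Jacobi polynomials, positive leading coefficient). Constants $r,t,s,\delta_n,\gamma_n,d_n$ (with superscripts; not to be confused with the endpoints or parameters) are defined by $$\widetilde P_n^{(d,c)}=r_n^{(d+1,c+1)}\widetilde P_n^{(d+1,c+1)}-t_{n-1}^{(d+1,c+1)}\widetilde P_{n-1}^{(d+1,c+1)}-s_{n-2}^{(d+1,c+1)}\widetilde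 P_{n-2}^{(d+1,c+1)},$$ $$y\widetilde P_n^{(d,c)}=\delta_n^{(d,c)}\widetilde P_{n+1}^{(d,c)}+\gamma_n^{(d,c)}\widetilde P_n^{(d,c)}+\delta_{n-1}^{(d,c)}\widetilde P_{n-1}^{(d,c)},\qquad \tfrac{\mathrm d}{\mathrm dy}\widetilde P_n^{(d,c)}=d_{n-1}^{(d+1,c+1)}\widetilde P_{n-1}^{(d+1,c+1)}.$$ The generalised Koornwinder polynomials are $$H_{n,k}^{(a,b,c,d)}(x,y)=R_{n-k}^{(a,b,c+d+2k+1)}(x)\,\rho(x)^k\,\widetilde P_k^{(d,c)}(y/\rho(x)),\quad 0\le k\le n,$$ orthonormal on $\Omega$ with respect to $W^{(a,b,c,d)}(x,y)=(\beta-x)^a(x-\alpha)^b(y-\gamma\rho(x))^c(\delta\rho(x)-y)^d$. $\mathbf H^{(a,b,c,d)}$ is the infinite row vector of all $H_{n,k}^{(a,b,c,d)}$, ordered in blocks $n=0,1,2,\dots$, block $n$ being $(H_{n,0},\dots,H_{n,n})$. Matrices. $J(w_R^{(a,b,s)})$ is the tridiagonal Jacobi matrix defined by $x\,\mathbf R^{(a,b,s)}=\mathbf R^{(a,b,s)}J(w_R^{(a,b,s)})$; for a polynomial $f$, $f(J)$ is the usual matrix polynomial (note $\rho^2$ and $\rho\rho'$ are polynomials in both cases). $\mathcal T_{(a,b,s)}^{(a',b',s')}$ is the upper triangular raising matrix defined by $\mathbf R^{(a,b,s)}=\mathbf R^{(a',b',s')}\mathcal T_{(a,b,s)}^{(a',b',s')}$.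 $D_\eta(w_R^{(a,b,s)})$ is the differentiation matrix defined by $\frac{\mathrm d}{\mathrm dx}\mathbf R^{(a,b,s)}=\mathbf R^{(a+1,b+1,s+1+\eta)}D_\eta(w_R^{(a,b,s)})$. Conventions. $A_{[i,j]}$ is the entry in row $i+1$, column $j+1$ of $A$, and is $0$ if $i<0$ or $j<0$. Terms $H_{m,j}$ with indices outside $0\le j\le m$ are omitted (zero). A matrix has bandwidths $(\sigma,\mu)$ if $A_{[i,j]}=0$ whenever $i-j>\sigma$ or $j-i>\mu$ ($\sigma$ or $\mu$ may be negative); block-bandwidths are defined in the same way, with block $(i,j)$ (of size $(i+1)\times(j+1)$) in place of entry $[i,j]$, and ''each block has bandwidths'' refers to bandwidths within the blocks. *)

(* Defs.v *)
From mathcomp Require Import all_boot all_order all_algebra.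
From mathcomp Require Import all_classical all_reals all_analysis.
Import Order.TTheory GRing.Theory Num.Theory.
Import numFieldNormedType.Exports.

Set Implicit Arguments.
Unset Strict Implicit.
Unset Printing Implicit Defensive.

Local Open Scope classical_set_scope.
Local Open Scope ring_scope.

(* lo, lo + 1, ..., hi; empty if hi < lo. *)
Definition zrange (lo hi : int) : seq int :=
  [seq lo + i%:Z | i <- iota 0 (absz (Num.max (0 : int) (hi - lo + 1)%R))].

Section InfiniteMatrices.
Context {R : realType}.

(* Infinite matrices, indexed from 0. *)
Definition imx := nat -> nat -> R.

Definition colfinite (A : imx) : Prop :=
  forall j, exists N, forall i, (N <= i)%N -> A i j = 0.

(* The sum is over the indices with a nonzero term: it is the usual entry of
   the product whenever B is column-finite. *)
Definition imx_mul (A B : imx) : imx :=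
  fun i j => \sum_(k \in [set: nat]) A i k * B k j.

Definition imx_id : imx := fun i j => (i == j)%:R.

(* The inverse in the algebra of column-finite matrices. *)
Definition imx_inv (A : imx) : imx :=
  xget (fun _ _ => 0) [set B : imx | colfinite B /\
    imx_mul A B = imx_id /\ imx_mul B A = imx_id].

Definition imx_pow (A : imx) (n : nat) : imx := iter n (imx_mul A) imx_id.

(* The matrix polynomial f(A). *)
Definition imx_horner (f : {poly R}) (A : imx) : imx :=
  fun i j => \sum_(l < size f) f`_l * imx_pow A l i j.

(* A_[i, j] for integers i and j: zero if i < 0 or j < 0. *)
Definition imx_entry (A : imx) (i j : int) : R :=
  match i, j with
  | Posz i', Posz j' => A i' j'
  | _, _ => 0
  end.

(* The column-finite matrix A with F = Q A, where F and Q are infinite row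
   vectors of polynomials; A is unique when Q n has degree n for all n. *)
Definition conn_mx (Q F : nat -> {poly R}) : imx :=
  xget (fun _ _ => 0) [set A : imx | colfinite A /\
    forall n, F n = \sum_(i \in [set: nat]) A i n *: Q i].

Definition mx_banded p q (A : 'M[R]_(p, q)) (sigma mu : int) : Prop :=
  forall (i : 'I_p) (j : 'I_q),
    (sigma < i%:Z - j%:Z) || (mu < j%:Z - i%:Z) -> A i j = 0.

(* Infinite block matrices whose block (m, n) has size (m+1) x (n+1). *)
Definition bmx := forall m n : nat, 'M[R]_(m.+1, n.+1).

Definition bmx_colfinite (D : bmx) : Prop :=
  forall n, exists N, forall m, (N <= m)%N -> D m n = 0.

Definition bmx_banded (D : bmx) (sigma mu : int) : Prop :=
  forall m n : nat,
    (sigma < m%:Z - n%:Z) || (mu < n%:Z - m%:Z) -> D m n = 0.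

End InfiniteMatrices.
Arguments imx R : clear implicits.
Arguments bmx R : clear implicits.

Declare Scope imx_scope.
Delimit Scope imx_scope with IM.
Notation "A *m B" := (imx_mul A B) : imx_scope.
Notation "A ^-1" := (imx_inv A) : imx_scope.

Section OrthonormalPolynomials.
Context {R : realType}.

Definition orthonormal_polys (l u : R) (w : R -> R)
    (P : nat -> {poly R}) : Prop :=
  [/\ forall n, size (P n) = n.+1,
      forall n, 0 < lead_coef (P n) &
      forall m n, \int[@lebesgue_measure R]_(x in `[l, u])
        ((P m).[x] * (P n).[x] * w x) = (m == n)%:R].

Definition opoly (l u : R) (w : R -> R) : nat -> {poly R} :=
  xget (fun=> 0) [set P | orthonormal_polys l u w P].

Definition weight_integrable (l u : R) (w : R -> R) : Prop :=
  (@lebesgue_measure R).-integrable `[l, u] (EFin \o w).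

Section Jacobi.
Context (gamma delta : R).

Definition wP (d c : R) (y : R) : R :=
  (delta - y) `^ d * (y - gamma) `^ c.

Definition Pn (d c : R) : nat -> {poly R} := opoly gamma delta (wP d c).

(* The superscript (d, c) of r, t, s and dJ is that of the target basis
   Pn d c, so the polynomials being expanded are Pn (d - 1) (c - 1) and their
   derivatives. *)
Definition raiseP (d c : R) : imx R :=
  conn_mx (Pn d c) (Pn (d - 1) (c - 1)).

Definition rJ (d c : R) (n : nat) : R := raiseP d c n n.
Definition tJ (d c : R) (n : nat) : R := - raiseP d c n n.+1.
Definition sJ (d c : R) (n : nat) : R := - raiseP d c n n.+2.

Definition multP (d c : R) : imx R :=
  conn_mx (Pn d c) (fun n => 'X * Pn d c n).

Definition deltaJ (d c : R) (n : nat) : R := multP d c n.+1 n.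
Definition gammaJ (d c : R) (n : nat) : R := multP d c n n.

Definition dJ (d c : R) (n : nat) : R :=
  conn_mx (Pn d c) (fun i => (Pn (d - 1) (c - 1) i)^`()) n n.+1.

End Jacobi.

(* The function rho is given by eta and the polynomial q = rho ^ (1 + eta):
   rho is a polynomial (case (i)) if eta = 0, and the square root of a
   polynomial (case (ii)) if eta = 1. *)
Section Koornwinder.
Context (alpha beta : R) (eta : bool) (q : {poly R}).

Definition rho (x : R) : R := if eta then Num.sqrt q.[x] else q.[x].

Definition rho2 : {poly R} := if eta then q else q ^+ 2.

(* rho * rho' is half the derivative of rho ^ 2. *)
Definition rho_drho : {poly R} := 2^-1 *: rho2^`().

Definition wR (a b s : R) (x : R) : R :=
  (beta - x) `^ a * (x - alpha) `^ b * rho x `^ s.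

Definition Rn (a b s : R) : nat -> {poly R} :=
  opoly alpha beta (wR a b s).

Definition jacobiR (a b s : R) : imx R :=
  conn_mx (Rn a b s) (fun n => 'X * Rn a b s n).

(* T_(a,b,s)^(a',b',s') *)
Definition raiseR (a b s a' b' s' : R) : imx R :=
  conn_mx (Rn a' b' s') (Rn a b s).

(* D_eta(w_R^(a,b,s)) *)
Definition diffR (a b s : R) : imx R :=
  conn_mx (Rn (a + 1) (b + 1) (s + 1 + eta%:R)) (fun n => (Rn a b s n)^`()).

Context (gamma delta : R).

Definition Omega : set (R * R) :=
  [set z | alpha <= z.1 <= beta /\ gamma * rho z.1 <= z.2 <= delta * rho z.1].

(* H_{n,k}^(a,b,c,d), meant for k <= n and rho x != 0. *)
Definition koornwinder (a b c d : R) (n k : nat) (x y : R) : R :=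
  (Rn a b (c + d + (2 * k)%:R + 1) (n - k)).[x] *
  rho x ^+ k * (Pn gamma delta d c k).[y / rho x].

(* H_{m,j} is zero for indices outside 0 <= j <= m. *)
Definition koornwinderz (a b c d : R) (m j : int) (x y : R) : R :=
  match m, j with
  | Posz m', Posz j' =>
      if (j' <= m')%N then koornwinder a b c d m' j' x y else 0
  | _, _ => 0
  end.

(* c_{m,k}^{x,(n,k)} *)
Definition cx0 (a b c d : R) (n k : nat) (m : int) : R :=
  let u := c + d + (2 * k)%:R in
  imx_entry (fun i j => rJ gamma delta (d + 1) (c + 1) k *
    (raiseR (a + 1) (b + 1) (u + 2 + eta%:R) (a + 1) (b + 1) (u + 3)
       *m diffR a b (u + 1))%IM i j)
  (m - k%:Z) (n%:Z - k%:Z).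

(* c_{m,k-2}^{x,(n,k)}, for 2 <= k *)
Definition cx2 (a b c d : R) (n k : nat) (m : int) : R :=
  let u := c + d + (2 * k)%:R in
  let J := jacobiR (a + 1) (b + 1) (u - 1) in
  let s := sJ gamma delta (d + 1) (c + 1) (k - 2) in
  imx_entry (fun i j =>
    - s *
      (imx_horner rho2 J *m diffR a b (u - 2 - eta%:R)
         *m (raiseR a b (u - 2 - eta%:R) a b (u + 1))^-1)%IM i j
    - (k%:R * s + deltaJ gamma delta (d + 1) (c + 1) (k - 2)
                  * dJ gamma delta (d + 1) (c + 1) (k - 1)) *
      (imx_horner rho_drho J *m raiseR a b (u - 1) (a + 1) (b + 1) (u - 1)
         *m (raiseR a b (u - 1) a b (u + 1))^-1)%IM i j)
  (m - k%:Z + 2) (n%:Z - k%:Z).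

End Koornwinder.

(* c_{m,k-1}^{x,(n,k)} in case (i), where rho = q, for 1 <= k *)
Definition cx1 (alpha beta : R) (q : {poly R}) (gamma delta : R)
    (a b c d : R) (n k : nat) (m : int) : R :=
  let u := c + d + (2 * k)%:R in
  let raise := raiseR alpha beta false q in
  let J := jacobiR alpha beta false q (a + 1) (b + 1) (u + 1) in
  let t := tJ gamma delta (d + 1) (c + 1) (k - 1) in
  imx_entry (fun i j =>
    - t *
      (imx_horner q J *m diffR alpha beta false q a b u
         *m (raise a b u a b (u + 1))^-1)%IM i j
    - (k%:R * t + gammaJ gamma delta (d + 1) (c + 1) (k - 1)
                  * dJ gamma delta (d + 1) (c + 1) (k - 1)) *
      (imx_horner q^`() J *m raise a b (u + 1) (a + 1) (b + 1) (u + 1))%IM i j)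
  (m - k%:Z + 1) (n%:Z - k%:Z).

(* D_x^(a,b,c,d): the column-finite block matrix D with
   d/dx H^(a,b,c,d) = H^(a+1,b+1,c+1,d+1) D, at the points of Omega where the
   formula for H makes sense, that is, off the vertices with rho x = 0. *)
Definition is_Dx (alpha beta : R) (eta : bool) (q : {poly R})
    (gamma delta a b c d : R) (D : bmx R) : Prop :=
  bmx_colfinite D /\
  forall (n : nat) (k : 'I_n.+1) (x y : R),
    Omega alpha beta eta q gamma delta (x, y) -> 0 < rho eta q x ->
    is_derive x (1 : R)
      (fun x' : R => koornwinder alpha beta eta q gamma delta a b c d n k x' y)
      (\sum_(m \in [set: nat]) \sum_(j < m.+1)
         koornwinder alpha beta eta q gamma delta
           (a + 1) (b + 1) (c + 1) (d + 1) m j x y * D m n j k).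

End OrthonormalPolynomials.

(* Main.v *)
Require Import Defs.
From HB Require Import structures.
From mathcomp Require Import all_boot all_order all_algebra.
From mathcomp Require Import all_classical all_reals all_analysis.
From mathcomp Require Import measurable_realfun.
From mathcomp Require Import ring lra zify.
Import Order.TTheory GRing.Theory Num.Theory.
Import numFieldNormedType.Exports.
Local Open Scope classical_set_scope.
Local Open Scope ring_scope.

Set Implicit Arguments.
Unset Strict Implicit.
Unset Printing Implicit Defensive.

(** Put z = y / rho x and R = R_{n-k}^(a,b,c+d+2k+1), and write Pt_j for the
Jacobi polynomials whose two parameters are raised by one.  Where rho x > 0,

  d/dx H_{n,k} = rho^k R' P_k(z) + rho^(k-2) (rho rho') R (k P_k(z) - z P_k'(z)),

which is [derive_koornwinder].  Both P_k and y P_k' are combinations of Pt_k,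
Pt_{k-1} and Pt_{k-2} ([jacobi_raise], [jacobi_mulX_deriv]), and comparing
leading terms shows that k P_k - y P_k' has no component on Pt_k.  Hence the
derivative is the sum over j = 0, 1, 2 of rho^(k-j) Pt_{k-j}(z) G_j(x), with

  G_0 = r_k R',
  G_1 = - t_{k-1} rho R' - (k t_{k-1} + gamma_{k-1} d_{k-1}) rho' R,
  G_2 = - s_{k-2} rho^2 R' - (k s_{k-2} + delta_{k-2} d_{k-1}) rho rho' R.

When rho is the square root of a polynomial the Jacobi weight is even, so that
t_{k-1} = gamma_{k-1} = 0 and G_1 drops out ([jacobi_symmetric]); thus every G_j is a
polynomial.  The three matrix products of the statement compute the
coefficients of G_j in the basis R_i^(a+1,b+1,c+d+2k+3-2j): a row vector of
polynomials times a connection, Jacobi, differentiation or inverse connection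
matrix is again a row vector of polynomials, and such products associate
([row_mul_mul]).

It remains to see which of these coefficients vanish.  For large i this is a
degree count.  For small i it is orthogonality, after the derivative has been
moved away from R.  Let X = (beta - x)(x - alpha), and let w be the weight with
exponents (a,b,s).  The Pearson equation ([pearson_wR]) says that the integral
of w (F' X rho^2 + F B) is 0 for every polynomial F, where B is the polynomial
for which this is the integral of the derivative of F X rho^2 w; that function
vanishes at both endpoints.  With F = R phi, the integral of X rho^2 R' phi
against w becomes, up to sign, the integral of R times a polynomial whose degree
is controlled by that of phi.  For G_2 the integrand contains the factor
rho'/rho, which is not a polynomial, both from the integration by parts and
from the second term of G_2.  The two contributions cancel exactly because

  k s_{k-2} + delta_{k-2} d_{k-1} = (c + d + 2k + 1) s_{k-2}

([jacobi_delta]), and this identity is a consequence of the Pearson equation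
of the Jacobi weight.  These three computations are [deriv_matrix],
[lower2_matrix] and [lower1_matrix].

Orthonormal polynomials exist because integration against such a weight is a
positive definite functional ([weight_int_gt0], [gram_schmidt]).  The block
matrix is unique ([is_Dx_unique]) because, at fixed x, the Pt_j(z) are linearly
independent on an interval of z, and then the R_i(x) are so on an interval of
x. *)

(** * Infinite matrices acting on sequences of polynomials *)

Lemma fsum_nat (V : nmodType) (f : nat -> V) (N : nat) :
  (forall i, (N <= i)%N -> f i = 0) ->
  \sum_(i \in [set: nat]) f i = \sum_(i < N) f i.
Proof.
move=> f0; rewrite fsbig_ord; apply/esym/fsbig_widen => // i [_ /= /negP].
by rewrite -leqNgt; exact: f0.
Qed.

Section RowVectors.
Context {R : realType}.
Implicit Types (Q F : nat -> {poly R}) (A B : imx R).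

Definition graded Q := forall n, size (Q n) = n.+1.

Definition row_mul Q A : nat -> {poly R} :=
  fun n => \sum_(i \in [set: nat]) A i n *: Q i.

Lemma row_mulE Q A n N : (forall i, (N <= i)%N -> A i n = 0) ->
  row_mul Q A n = \sum_(i < N) A i n *: Q i.
Proof. by move=> A0; apply: fsum_nat => i /A0 ->; rewrite scale0r. Qed.

(** Finitely many columns of a column-finite matrix have a common height; this is
    what turns a product of column-finite matrices into finite sums. *)
Lemma colfinite_upto A M : colfinite A ->
  exists N, forall i j, (j < M)%N -> (N <= i)%N -> A i j = 0.
Proof.
move=> fA; elim: M => [|M [N AN]]; first by exists 0%N.
have [N' AN'] := fA M; exists (maxn N N') => i j.
rewrite ltnS leq_eqVlt geq_max => /predU1P[->|jM] /andP[Ni N'i]; first exact: AN'.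
exact: AN.
Qed.

Lemma colfinite_mul A B : colfinite A -> colfinite B -> colfinite (imx_mul A B).
Proof.
move=> fA fB j; have [M BM] := fB j; have [N AN] := colfinite_upto M fA.
exists N => i Ni; rewrite /imx_mul (@fsum_nat _ _ M).
  by rewrite big1// => k _; rewrite AN ?mul0r.
by move=> k /BM ->; rewrite mulr0.
Qed.

Lemma row_mul_mul Q A B : colfinite A -> colfinite B ->
  row_mul Q (imx_mul A B) = row_mul (row_mul Q A) B.
Proof.
move=> fA fB; apply/funext => n.
have [M BM] := fB n; have [N AN] := colfinite_upto M fA.
have AB i : imx_mul A B i n = \sum_(k < M) A i k * B k n.
  by rewrite /imx_mul (@fsum_nat _ _ M)// => k /BM ->; rewrite mulr0.
rewrite (@row_mulE _ _ _ N); last first.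
  by move=> i Ni; rewrite AB big1// => k _; rewrite AN ?mul0r.
rewrite (@row_mulE _ B n M)//.
under eq_bigr do rewrite AB scaler_suml.
rewrite exchange_big/=; apply: eq_bigr => k _.
rewrite (@row_mulE _ A k N); last by move=> i; exact: AN.
by rewrite scaler_sumr; apply: eq_bigr => i _; rewrite scalerA mulrC.
Qed.

Lemma colfinite_id : colfinite (@imx_id R).
Proof. by move=> j; exists j.+1 => i /gtn_eqF; rewrite /imx_id => ->. Qed.

Lemma row_mul_id Q : row_mul Q imx_id = Q.
Proof.
apply/funext => n; rewrite (@row_mulE _ _ n n.+1) => [|i /gtn_eqF]; last first.
  by rewrite /imx_id => ->.
rewrite big_ord_recr/= /imx_id eqxx scale1r big1 ?add0r// => i _.
by rewrite ltn_eqF ?scale0r.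
Qed.

Lemma graded_lead Q n : graded Q -> (Q n)`_n != 0.
Proof.
move=> gQ; have -> : (Q n)`_n = lead_coef (Q n) by rewrite lead_coefE gQ.
by rewrite lead_coef_eq0 -size_poly_eq0 gQ.
Qed.

Lemma graded_span Q : graded Q -> forall N (p : {poly R}), (size p <= N)%N ->
  exists c : nat -> R, (forall i, (N <= i)%N -> c i = 0) /\
    p = \sum_(i < N) c i *: Q i.
Proof.
move=> gQ; elim=> [|N IH] p pN.
  exists (fun=> 0); split=> //.
  by rewrite big_ord0; apply/eqP; rewrite -size_poly_eq0 -leqn0.
have l0 := graded_lead N gQ.
(* Subtracting e Q_N from p lowers its degree. *)
pose e := p`_N / (Q N)`_N.
have [|c [c0 pE]] := IH (p - e *: Q N).
  apply/leq_sizeP => j Nj; rewrite coefB coefZ.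
  have [->|jN] := eqVneq j N; first by rewrite divfK// subrr.
  have {jN}Nj : (N < j)%N by rewrite ltn_neqAle eq_sym jN.
  by rewrite [p`_j]nth_default ?(leq_trans pN)// nth_default ?gQ// mulr0 subrr.
exists (fun i => if i == N then e else c i); split=> [i Ni|].
  by rewrite gtn_eqF// c0// ltnW.
rewrite big_ord_recr/= eqxx -(subrK (e *: Q N) p) pE; congr (_ + _).
by apply: eq_bigr => i _; rewrite ltn_eqF.
Qed.

Lemma graded_free Q (c : nat -> R) N : graded Q ->
  \sum_(i < N) c i *: Q i = 0 -> forall i, (i < N)%N -> c i = 0.
Proof.
move=> gQ; elim: N => // N IH; rewrite big_ord_recr/= => s0.
have l0 := graded_lead N gQ.
have cN : c N = 0.
  have := congr1 (fun p : {poly R} => p`_N) s0.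
  rewrite coefD coef_sum big1 ?add0r.
    by rewrite coefZ coef0 => /eqP; rewrite mulf_eq0 (negPf l0) orbF => /eqP.
  by move=> i _; rewrite coefZ nth_default ?mulr0// gQ.
move: s0; rewrite cN scale0r addr0 => /IH ci i.
by rewrite ltnS leq_eqVlt => /predU1P[->//|/ci].
Qed.

(** Expansions in a graded family are unique, so the one given by column n has
    only the terms which the degree of the polynomial requires. *)
Lemma row_mul_size Q A n i : graded Q -> colfinite A ->
  (size (row_mul Q A n) <= i)%N -> A i n = 0.
Proof.
move=> gQ fA; set p := row_mul Q A n => pi.
have [N AN] := fA n; have [Ni|iN] := leqP N i; first exact: AN.
have [c [c0 pE]] := graded_span gQ (leqnn (size p)).
suff /(@graded_free Q (fun i => A i n - c i) N gQ)/(_ i iN) :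
    \sum_(i < N) (A i n - c i) *: Q i = 0.
  by rewrite c0// subr0.
under eq_bigr do rewrite scalerBl.
rewrite big_split/= sumrN; apply/eqP; rewrite subr_eq0; apply/eqP.
rewrite -(row_mulE _ AN) -/p [LHS]pE.
rewrite (big_ord_widen N (fun i => c i *: Q i)); last by lia.
rewrite big_mkcond/=; apply: eq_bigr => j _; case: ifPn => //.
by rewrite -leqNgt => /c0 ->; rewrite scale0r.
Qed.

Lemma row_mul_inj Q A B : graded Q -> colfinite A -> colfinite B ->
  row_mul Q A = row_mul Q B -> A = B.
Proof.
move=> gQ fA fB AB; apply/funext => i; apply/funext => n.
have [N AN] := fA n; have [M BM] := fB n.
have bA j : (maxn N M <= j)%N -> A j n = 0.
  by rewrite geq_max => /andP[/AN].
have bB j : (maxn N M <= j)%N -> B j n = 0.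
  by rewrite geq_max => /andP[_ /BM].
have [/[dup]/bA -> /bB -> //|iN] := leqP (maxn N M) i.
apply/eqP; rewrite -subr_eq0; apply/eqP.
apply: (@graded_free Q (fun i => A i n - B i n) (maxn N M)) => //.
under eq_bigr do rewrite scalerBl.
rewrite big_split/= sumrN -(row_mulE _ bA) -(row_mulE _ bB) AB.
by rewrite subrr.
Qed.

Lemma conn_mxP Q F : graded Q ->
  colfinite (conn_mx Q F) /\ row_mul Q (conn_mx Q F) = F.
Proof.
move=> gQ; rewrite /conn_mx; case: xgetP => [A -> [fA FA]|none].
  by split=> //; apply/funext => n; rewrite FA.
have /choice[c cP] := fun n => graded_span gQ (leqnn (size (F n))).
case: (none (fun i n => c n i)); split=> [n|n].
  by exists (size (F n)); apply (cP n).1.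
by have [c0 FE] := cP n; rewrite [LHS]FE -(@row_mulE Q (fun i n => c n i)).
Qed.

Lemma colfinite_conn Q F : graded Q -> colfinite (conn_mx Q F).
Proof. by move=> /(conn_mxP F)[]. Qed.

Lemma row_mul_conn Q F : graded Q -> row_mul Q (conn_mx Q F) = F.
Proof. by move=> /(conn_mxP F)[]. Qed.

(** The two-sided inverse is the connection matrix in the opposite direction. *)
Lemma conn_mx_inv Q F : graded Q -> graded F ->
  colfinite (imx_inv (conn_mx Q F)) /\ row_mul F (imx_inv (conn_mx Q F)) = Q.
Proof.
move=> gQ gF; have [fT QT] := conn_mxP F gQ; have [fS FS] := conn_mxP Q gF.
set T := conn_mx Q F in fT QT *; set S := conn_mx F Q in fS FS.
have TS : imx_mul T S = imx_id.
  apply: (row_mul_inj gQ); [exact: colfinite_mul|exact: colfinite_id|].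
  by rewrite row_mul_mul// QT FS row_mul_id.
have ST : imx_mul S T = imx_id.
  apply: (row_mul_inj gF); [exact: colfinite_mul|exact: colfinite_id|].
  by rewrite row_mul_mul// FS QT row_mul_id.
rewrite /imx_inv; case: xgetP => [B _ [fB [TB _]]|/(_ S) []//].
by split=> //; rewrite -QT -row_mul_mul// TB row_mul_id.
Qed.

Lemma colfinite_pow A l : colfinite A -> colfinite (imx_pow A l).
Proof.
move=> fA; elim: l => [|l IH]; first exact: colfinite_id.
exact: colfinite_mul.
Qed.

Lemma row_mul_scale (p : {poly R}) Q A : colfinite A ->
  row_mul (fun n => p * Q n) A = (fun n => p * row_mul Q A n).
Proof.
move=> fA; apply/funext => n; have [N AN] := fA n.
rewrite !(row_mulE _ AN) mulr_sumr; apply: eq_bigr => i _.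
by rewrite scalerAr.
Qed.

Lemma colfinite_horner (f : {poly R}) A : colfinite A -> colfinite (imx_horner f A).
Proof.
move=> fA j.
have /choice[N AN] : forall l, exists N, forall i, (N <= i)%N -> imx_pow A l i j = 0.
  by move=> l; apply: colfinite_pow.
exists (\max_(l < size f) N l) => i /bigmax_leqP Ni.
by rewrite /imx_horner big1// => l _; rewrite AN ?mulr0// Ni.
Qed.

(** By induction, the powers of the Jacobi matrix represent multiplication by the
    powers of the variable. *)
Lemma row_mul_horner (f : {poly R}) Q : graded Q ->
  row_mul Q (imx_horner f (conn_mx Q (fun n => 'X * Q n))) = (fun n => f * Q n).
Proof.
move=> gQ; have [fJ QJ] := conn_mxP (fun n => 'X * Q n) gQ.
set J := conn_mx _ _ in fJ QJ *.
have powJ l : row_mul Q (imx_pow J l) = fun n => 'X^l * Q n.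
  elim: l => [|l IH].
    by rewrite row_mul_id; apply/funext => n; rewrite mul1r.
  rewrite /= row_mul_mul//; last exact: colfinite_pow.
  rewrite QJ row_mul_scale; last exact: colfinite_pow.
  by rewrite IH; apply/funext => n; rewrite mulrA exprS.
apply/funext => n; have [N0 HN] := colfinite_horner f fJ n.
have /choice[N AN] : forall l, exists N, forall i, (N <= i)%N -> imx_pow J l i n = 0.
  by move=> l; apply: colfinite_pow.
pose M := maxn N0 (\max_(l < size f) N l).
rewrite (@row_mulE _ _ _ M); last by move=> i; rewrite geq_max => /andP[/HN].
under eq_bigr do rewrite scaler_suml.
rewrite exchange_big/= -[f in RHS]coefK poly_def mulr_suml.
apply: eq_bigr => l _; rewrite -scalerAl -[_ * Q n]/((fun m => 'X^l * Q m) n) -powJ.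
rewrite (@row_mulE _ _ _ M).
  by rewrite scaler_sumr; apply: eq_bigr => i _; rewrite scalerA.
move=> i; rewrite geq_max => /andP[_ /bigmax_leqP Ni]; rewrite AN//; exact: Ni.
Qed.

Lemma row_mul_lin Q A B (x y : R) : colfinite A -> colfinite B ->
  colfinite (fun i j => x * A i j + y * B i j) /\
  row_mul Q (fun i j => x * A i j + y * B i j) =
  fun n => x *: row_mul Q A n + y *: row_mul Q B n.
Proof.
move=> fA fB.
have bnd n : exists N, forall i, (N <= i)%N -> A i n = 0 /\ B i n = 0.
  have [N AN] := fA n; have [M BM] := fB n; exists (maxn N M) => i.
  by rewrite geq_max => /andP[/AN -> /BM ->].
split=> [n|]; first by have [N AB] := bnd n; exists N => i /AB[-> ->]; rewrite !mulr0 addr0.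
apply/funext => n; have [N AB] := bnd n.
rewrite !(@row_mulE _ _ _ N); [|by move=> i /AB[]..|].
  rewrite !scaler_sumr -big_split/=; apply: eq_bigr => i _.
  by rewrite scalerDl !scalerA.
by move=> i /AB[-> ->]; rewrite !mulr0 addr0.
Qed.

End RowVectors.

(** * Orthonormal polynomials of a positive functional *)

Section PolySize.
Context {R : realType}.
Implicit Types p q : {poly R}.

Lemma sizeD_le p q n : (size p <= n)%N -> (size q <= n)%N -> (size (p + q)%R <= n)%N.
Proof. by move=> pn qn; rewrite (leq_trans (size_polyD _ _))// geq_max pn. Qed.

Lemma sizeM_le p q m n : (size p <= m)%N -> (size q <= n)%N ->
  (size (p * q)%R <= (m + n).-1)%N.
Proof. by move=> pm qn; apply: leq_trans (size_polyMleq _ _) _; lia. Qed.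

Lemma size_deriv_le p n : (size p <= n)%N -> (size p^`()%R <= n.-1)%N.
Proof.
move=> pn; apply/leq_sizeP => j nj; rewrite coef_deriv nth_default ?mul0rn//.
by apply: leq_trans pn _; lia.
Qed.

Lemma sizeZ_le (e : R) p n : (size p <= n)%N -> (size (e *: p) <= n)%N.
Proof. exact: leq_trans (size_scale_leq _ _). Qed.

Lemma sizeN_le p n : (size p <= n)%N -> (size (- p) <= n)%N.
Proof. by rewrite size_polyN. Qed.

End PolySize.

Section Functional.
Context {R : realType}.
Implicit Types (P Q : nat -> {poly R}) (A : imx R) (L : {scalar {poly R}}).

Definition orthonormal L P :=
  [/\ graded P, forall n, 0 < lead_coef (P n) &
      forall m n, L (P m * P n) = (m == n)%:R].

Lemma functional_suml L (c : nat -> R) Q (p : {poly R}) N :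
  L ((\sum_(i < N) c i *: Q i) * p) = \sum_(i < N) c i * L (Q i * p).
Proof.
rewrite mulr_suml raddf_sum/=; apply: eq_bigr => i _.
by rewrite -scalerAl linearZ.
Qed.

Lemma orthonormal_low L P (p : {poly R}) n : orthonormal L P -> (size p <= n)%N ->
  L (p * P n) = 0.
Proof.
move=> [gP _ oP] pn; have [c [c0 ->]] := graded_span gP pn.
rewrite functional_suml big1// => i _.
by rewrite oP ltn_eqF ?mulr0.
Qed.

Lemma orthonormal_coef L Q A i n : orthonormal L Q -> colfinite A ->
  A i n = L (Q i * row_mul Q A n).
Proof.
move=> [gQ _ oQ] fA; have [N AN] := fA n.
rewrite (@row_mulE _ _ _ _ (maxn N i.+1)); last first.
  by move=> j; rewrite geq_max => /andP[/AN].
rewrite mulrC (functional_suml L (fun j => A j n)).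
rewrite (bigD1 (Ordinal (leq_maxr N i.+1)))//= oQ eqxx mulr1 big1 ?addr0//.
by move=> j /negPf ji; rewrite oQ -val_eqE/= in ji *; rewrite ji mulr0.
Qed.

Lemma conn_coef L Q F i n : orthonormal L Q ->
  conn_mx Q F i n = L (Q i * F n).
Proof.
move=> oQ; have gQ : graded Q by case: oQ.
by rewrite (orthonormal_coef _ _ oQ (colfinite_conn F gQ)) row_mul_conn.
Qed.

(** P n is orthogonal to all lower degrees, hence a multiple of Q n; the norm and
    the sign of the leading coefficient fix the factor. *)
Lemma orthonormal_unique L P Q : orthonormal L P -> orthonormal L Q -> P = Q.
Proof.
move=> oP oQ; apply/funext => n.
have [gP lP nP] := oP; have [gQ lQ nQ] := oQ.
have sP : (size (P n) <= n.+1)%N by rewrite gP.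
have [c [_ PE]] := graded_span gQ sP.
have cE i : (i <= n)%N -> L (Q i * P n) = c i.
  rewrite -ltnS => iN; rewrite mulrC {1}PE functional_suml (bigD1 (Ordinal iN))//=.
  rewrite nQ eqxx mulr1 big1 ?addr0// => j /negPf ji.
  by rewrite nQ -val_eqE/= in ji *; rewrite ji mulr0.
have {PE}PE : P n = c n *: Q n.
  rewrite {1}PE big_ord_recr/= big1 ?add0r// => i _.
  by rewrite -cE 1?ltnW// (orthonormal_low oP) ?gQ ?scale0r.
have c0 : 0 < c n by have := lP n; rewrite PE lead_coefZ pmulr_lgt0.
have : L (P n * P n) = 1 by rewrite nP eqxx.
rewrite PE -scalerAl linearZ/= -scalerAr linearZ/= nQ eqxx mulr1 -expr2.
by move/eqP; rewrite sqrp_eq1 ?ltW// => /eqP ->; rewrite scale1r.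
Qed.

Section GramSchmidt.
Variable L : {scalar {poly R}}.
Hypothesis L_gt0 : forall p : {poly R}, p != 0 -> 0 < L (p * p).

Let project (s : seq {poly R}) (p : {poly R}) : {poly R} :=
  p - \sum_(f <- s) L (f * p) *: f.

Let next (s : seq {poly R}) : {poly R} :=
  let p := project s 'X^(size s) in (Num.sqrt (L (p * p)))^-1 *: p.

Let gs n : seq {poly R} := iter n (fun s => rcons s (next s)) [::].

Let P n : {poly R} := next (gs n).

Let gsE n : gs n = [seq P i | i <- iota 0 n].
Proof. by elim: n => // n IH; rewrite -addn1 iotaD map_cat/= -IH addn1 cats1. Qed.

Let projE n p : project (gs n) p = p - \sum_(i < n) L (P i * p) *: P i.
Proof.
by rewrite /project gsE big_map -[X in iota 0 X]subn0 -/(index_iota 0 n) big_mkord.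
Qed.

Lemma gram_schmidt : exists P, orthonormal L P.
Proof.
exists P.
have szgs n : size (gs n) = n by rewrite gsE size_map size_iota.
suff H n : [/\ size (P n) = n.+1, 0 < lead_coef (P n), L (P n * P n) = 1 &
    forall m, (m < n)%N -> L (P m * P n) = 0].
  split=> [n|n|m n]; [by case: (H n)..|].
  have [mn|nm|->] := ltngtP m n; [by case: (H n) => _ _ _ ->| |by case: (H n)].
  by rewrite mulrC; case: (H m) => _ _ _ ->.
elim/ltn_ind: n => n IH; pose p := project (gs n) 'X^n.
have -> : P n = (Num.sqrt (L (p * p)))^-1 *: p by rewrite /P /next szgs.
have pE : p = 'X^n - \sum_(i < n) L (P i * 'X^n) *: P i by rewrite /p projE.
have szs : (size (\sum_(i < n) L (P i * 'X^n) *: P i)%R <= n)%N.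
  apply: (leq_trans (size_sum _ _ _)); apply/bigmax_leqP => i _.
  by apply: sizeZ_le; have [-> _ _ _] := IH _ (ltn_ord i).
have szp : size p = n.+1.
  by rewrite pE size_polyDl size_polyXn// size_polyN.
have lp : lead_coef p = 1.
  by rewrite pE lead_coefDl ?lead_coefXn// size_polyXn size_polyN.
have p0 : p != 0 by rewrite -size_poly_eq0 szp.
have s0 : 0 < Num.sqrt (L (p * p)) by rewrite sqrtr_gt0 L_gt0.
split.
- by rewrite size_scale ?szp// invr_eq0 gt_eqF.
- by rewrite lead_coefZ lp mulr1 invr_gt0.
- rewrite -scalerAl linearZ/= -scalerAr linearZ/= mulrA -invfM -expr2.
  by rewrite sqr_sqrtr ?mulVf ?ltW ?gt_eqF ?L_gt0.
move=> m mn; rewrite -scalerAr linearZ/=.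
suff -> : L (P m * p) = 0 by rewrite mulr0.
rewrite pE mulrBr raddfB/= [P m * \sum_(i < n) _]mulrC.
rewrite (functional_suml L (fun i => L (P i * 'X^n))).
have nPm i : (i < n)%N -> L (P i * P m) = (i == m)%:R.
  move=> iN; have [im|mi|->] := ltngtP i m; last by have [] := IH m mn.
    by have [_ _ _ ->] := IH m mn.
  by rewrite mulrC; have [_ _ _ ->] := IH i iN.
rewrite (bigD1 (Ordinal mn))//= nPm// eqxx mulr1 big1 ?addr0 => [|i im].
  by rewrite subrr.
by rewrite nPm// -val_eqE/= in im *; rewrite (negPf im) mulr0.
Qed.

End GramSchmidt.

Lemma functional_even L : (forall j, L 'X^(j.*2.+1) = 0) ->
  forall p, L (p \Po - 'X) = L p.
Proof.
move=> odd0 p; rewrite comp_polyE -[p in RHS]coefK poly_def !raddf_sum/=.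
apply: eq_bigr => i _; rewrite !linearZ/= exprNn; congr (_ * _).
have [oi|ei] := boolP (odd i); last first.
  by rewrite -signr_odd (negPf ei) mul1r.
have iE : nat_of_ord i = i./2.*2.+1 by rewrite -[LHS]odd_double_half oi.
by rewrite -signr_odd oi expr1 mulN1r raddfN/= iE odd0 oppr0.
Qed.

(** (-1)^n P_n(-x) is another orthonormal family for the same functional. *)
Lemma orthonormal_parity L P : (forall p, L (p \Po - 'X) = L p) ->
  orthonormal L P -> forall n, P n \Po - 'X = (-1) ^+ n *: P n.
Proof.
move=> evL oP n; have [gP lP nP] := oP.
have szX : size (- 'X : {poly R}) = 2%N by rewrite size_polyN size_polyX.
suff /(orthonormal_unique oP)/(congr1 (fun F => F n)) PE :
    orthonormal L (fun n => (-1) ^+ n *: (P n \Po - 'X)).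
  by rewrite [in RHS]PE scalerA -exprD addnn -mul2n exprM sqrrN !expr1n scale1r.
have lX : lead_coef (- 'X : {poly R}) = -1 by rewrite lead_coefN lead_coefX.
split=> [m|m|i j].
- rewrite size_scale ?signr_eq0// size_comp_poly2// gP//.
- rewrite lead_coefZ lead_coef_comp ?szX// gP lX/= mulrCA.
  by rewrite -exprD addnn -mul2n exprM sqrrN !expr1n mulr1.
rewrite -scalerAl -scalerAr !linearZ/= -comp_polyM evL nP.
have [->|] := eqVneq i j; last by rewrite !mulr0.
by rewrite mulr1 -exprD addnn -mul2n exprM sqrrN !expr1n.
Qed.

End Functional.

(** * Pearson equations and the Jacobi connection coefficients *)

Section Pearson.
Context {R : realType}.
Implicit Types (L : {scalar {poly R}}) (A B F f g : {poly R}).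

(** If L is integration against w, this says that (A w)' = B w and that the
    boundary terms vanish. *)
Definition pearson L A B := forall F, L (F^`() * A + F * B) = 0.

Lemma pearson_parts L A B f g : pearson L A B ->
  L (A * (f * g^`())) = - L ((f^`() * A + f * B) * g).
Proof.
move=> LAB; apply/eqP; rewrite -subr_eq0 opprK -raddfD/=; apply/eqP.
by rewrite -[RHS](LAB (f * g)); congr (L _); rewrite derivM; ring.
Qed.

(** The product 'X f has degree m + 1 and B 'X agrees with e A in degree 2, so the
    terms of degree m + 2 cancel: the leading coefficient of ('X f)' is m + 1
    times that of f. *)
Lemma derivXM_size f m e A B : size f = m.+1 -> (size A <= 3)%N ->
  (size (B * 'X - e *: A)%R <= 2)%N ->
  (size (('X * f)^`() * A + ('X * f) * B - (m.+1%:R + e) *: (A * f))%R <= m.+2)%N.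
Proof.
move=> sf sA sB.
have -> : ('X * f)^`() * A + ('X * f) * B - (m.+1%:R + e) *: (A * f) =
    (('X * f)^`() - m.+1%:R *: f) * A + f * (B * 'X - e *: A).
  by rewrite scalerDl mulrBr mulrBl -!scalerAl -scalerAr [A * f]mulrC; ring.
apply: sizeD_le; last by apply: leq_trans (sizeM_le (eq_leq sf) sB) _; lia.
apply: leq_trans (sizeM_le (_ : _ <= m)%N sA) _; last by lia.
apply/leq_sizeP => j mj; rewrite coefB coefZ coef_deriv coefXM/= mulr_natl.
have [->|jm] := eqVneq j m; first by rewrite subrr.
by rewrite nth_default ?mul0rn ?subrr// sf ltn_neqAle eq_sym jm.
Qed.

End Pearson.

(** P and Pt are orthonormal for L and for p |-> L (A p), where L satisfies a Pearson
    equation with A of degree 2 and B of degree 1; for the Jacobi weight, e is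
    the sum of the two exponents plus 2. *)
Section JacobiAlgebra.
Context {R : realType}.
Variables (L Lt : {scalar {poly R}}) (P Pt : nat -> {poly R}).
Variables (A B : {poly R}) (e : R).
Hypotheses (oP : orthonormal L P) (oPt : orthonormal Lt Pt).
Hypothesis LtE : forall p, Lt p = L (A * p).
Hypotheses (sA : (size A <= 3)%N) (sB : (size (B * 'X - e *: A)%R <= 2)%N).
Hypothesis LAB : pearson L A B.

Let gP : graded P. Proof. by case: oP. Qed.
Let gPt : graded Pt. Proof. by case: oPt. Qed.

Let raise := conn_mx Pt P.
Let diff := conn_mx Pt (fun i => (P i)^`()).
Let mult := conn_mx Pt (fun i => 'X * Pt i).

Let size_B : (size B <= 2)%N.
Proof.
have [->|B0] := eqVneq B 0; first by rewrite size_poly0.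
rewrite -ltnS -(size_mulX B0) -(subrK (e *: A) (B * 'X)).
by apply: sizeD_le; [exact: leq_trans sB _|exact: sizeZ_le].
Qed.

Lemma raise_upper i n : (n < i)%N -> raise i n = 0.
Proof.
by move=> ni; rewrite /raise (conn_coef _ _ _ oPt) mulrC (orthonormal_low oPt)// gP.
Qed.

Lemma raise_band i n : (i.+2 < n)%N -> raise i n = 0.
Proof.
move=> ni; rewrite /raise (conn_coef _ _ _ oPt) LtE mulrA (orthonormal_low oP)//.
by apply: leq_trans (sizeM_le sA (eq_leq (gPt i))) _; lia.
Qed.

(** After integration by parts P n is paired with a polynomial of degree i + 1, so
    derivatives of the P n are again orthogonal. *)
Lemma diff_diag i n : i.+1 != n -> diff i n = 0.
Proof.
rewrite neq_ltn => /orP[ni|ni].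
  rewrite /diff (conn_coef _ _ _ oPt) LtE (pearson_parts _ _ LAB).
  rewrite (orthonormal_low oP) ?oppr0//.
  have sPt := eq_leq (gPt i); apply: leq_trans (sizeD_le _ _) ni.
    by apply: leq_trans (sizeM_le (size_deriv_le sPt) sA) _; lia.
  by apply: leq_trans (sizeM_le sPt size_B) _; lia.
rewrite /diff (conn_coef _ _ _ oPt) mulrC (orthonormal_low oPt)//.
by apply: leq_trans (size_deriv_le (eq_leq (gP n))) _; lia.
Qed.

Lemma mult_sym i n : mult i n = mult n i.
Proof. by rewrite /mult !(conn_coef _ _ _ oPt); congr (Lt _); ring. Qed.

Lemma mult_upper i n : (n.+1 < i)%N -> mult i n = 0.
Proof.
move=> ni; rewrite /mult (conn_coef _ _ _ oPt) mulrC (orthonormal_low oPt)//.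
by rewrite mulrC size_mulX ?gPt// -size_poly_eq0 gPt.
Qed.

Lemma deriv_orthonormal n : (P n)^`() = diff n.-1 n *: Pt n.-1.
Proof.
rewrite -[LHS]/((fun i => (P i)^`()) n) -(row_mul_conn (fun i => (P i)^`()) gPt).
rewrite (@row_mulE _ _ _ _ n.+1); last by move=> i ni; rewrite -/diff diff_diag//; lia.
have nn : (n.-1 < n.+1)%N by lia.
rewrite (bigD1 (Ordinal nn))//= -/diff big1 ?addr0// => i.
rewrite -val_eqE/= => ni; rewrite diff_diag ?scale0r//.
by apply: contra ni => /eqP/(congr1 predn) /= ->.
Qed.

Lemma raise_expand n : P n = raise n n *: Pt n
  + (if (0 < n)%N then raise n.-1 n *: Pt n.-1 else 0)
  + (if (1 < n)%N then raise n.-2 n *: Pt n.-2 else 0).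
Proof.
have bnd i : (n.+1 <= i)%N -> conn_mx Pt P i n = 0 by exact: raise_upper.
rewrite -[LHS]/(P n) -{1}(row_mul_conn P gPt) (row_mulE _ bnd) -/raise.
case: n bnd => [|[|n]] _.
- by rewrite big_ord_recr big_ord0/= add0r !addr0.
- by rewrite !big_ord_recr big_ord0/= add0r addr0 addrC.
rewrite !big_ord_recr/= big1 ?add0r; first by rewrite addrC [X in _ + X]addrC addrA.
by move=> i _; rewrite raise_band ?scale0r//; have := ltn_ord i; lia.
Qed.

(** Both sides are the component on Pt n.+1 of a polynomial with leading term
    n.+1 times that of P n.+1. *)
Lemma mulX_deriv_diag n : diff n n.+1 * mult n.+1 n = n.+1%:R * raise n.+1 n.+1.
Proof.
rewrite /mult /raise !(conn_coef _ _ _ oPt) -!linearZ/=.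
apply/eqP; rewrite -subr_eq0 -raddfB/= !scalerAr -mulrBr.
rewrite -(deriv_orthonormal n.+1) mulrC (orthonormal_low oPt)//.
apply/leq_sizeP => j nj; rewrite coefB coefZ coefXM coef_deriv.
case: j nj => // j nj; rewrite /= mulr_natl.
move: nj; rewrite ltnS leq_eqVlt => /predU1P[->|nj]; first by rewrite subrr.
by rewrite nth_default ?mul0rn ?subrr// gP.
Qed.

(** Integration by parts turns the component of 'X P_{n+2}' on Pt n into the
    pairing, up to sign, of P_{n+2} with a polynomial whose coefficient in degree
    n + 2 is n + 1 + e times that of A Pt_n. *)
Lemma mulX_deriv_low n :
  diff n.+1 n.+2 * mult n.+1 n = - (n.+1%:R + e) * raise n n.+2.
Proof.
rewrite -(mult_sym n) /mult /raise !(conn_coef _ _ _ oPt) -linearZ/=.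
rewrite !scalerAr -(deriv_orthonormal n.+2) !LtE mulrA [Pt n * 'X]mulrC.
rewrite (pearson_parts _ _ LAB) mulNr; congr (- _).
rewrite mulrA -linearZ/= scalerAl; apply/eqP; rewrite -subr_eq0 -raddfB/= -mulrBl.
by rewrite (orthonormal_low oP)// derivXM_size.
Qed.

Lemma mulX_deriv_expand n : 'X * (P n)^`() = (n%:R * raise n n) *: Pt n
  + (if (0 < n)%N then (mult n.-1 n.-1 * diff n.-1 n) *: Pt n.-1 else 0)
  + (if (1 < n)%N then (mult n.-1 n.-2 * diff n.-1 n) *: Pt n.-2 else 0).
Proof.
case: n => [|n].
  have := size_deriv_le (eq_leq (gP 0)); rewrite size_poly_leq0 => /eqP ->.
  by rewrite mulr0 mul0r scale0r !addr0.
rewrite deriv_orthonormal -scalerAr/=.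
have -> : 'X * Pt n = mult n.+1 n *: Pt n.+1 + mult n n *: Pt n +
    (if (0 < n)%N then mult n n.-1 *: Pt n.-1 else 0).
  have bnd i : (n.+2 <= i)%N -> mult i n = 0 by exact: mult_upper.
  rewrite -[LHS]/((fun i => 'X * Pt i) n) -(row_mul_conn (fun i => 'X * Pt i) gPt).
  rewrite (row_mulE _ bnd) -/mult.
  case: n bnd => [|n] _.
    by rewrite !big_ord_recr big_ord0/= add0r addr0 addrC.
  rewrite !big_ord_recr/= big1 ?add0r.
    by rewrite [mult n n.+1]mult_sym addrC [X in _ + X]addrC addrA.
  move=> i _; rewrite mult_sym mult_upper ?scale0r//.
  by have := ltn_ord i; lia.
rewrite !scalerDr !scalerA mulX_deriv_diag [diff n n.+1 * mult n n]mulrC.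
by case: n => [|n]/=; rewrite ?scaler0// scalerA [diff n.+1 n.+2 * mult n.+1 n]mulrC.
Qed.

Hypothesis evLt : forall p, Lt (p \Po - 'X) = Lt p.
Hypothesis evL : forall p, L (p \Po - 'X) = L p.

Lemma mult_even n : mult n n = 0.
Proof.
rewrite /mult (conn_coef _ _ _ oPt); set p := Pt n * _.
have : Lt p = - Lt p.
  rewrite -{1}evLt /p !comp_polyM comp_polyX (orthonormal_parity evLt oPt).
  rewrite -raddfN/=; congr (Lt _).
  rewrite -scalerAl -!scalerAr scalerA -exprD addnn -mul2n exprM sqrrN !expr1n.
  by rewrite scale1r mulNr mulrN.
by move=> ?; lra.
Qed.

Lemma raise_even n : raise n n.+1 = 0.
Proof.
rewrite /raise (conn_coef _ _ _ oPt); set p := Pt n * _.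
have : Lt p = - Lt p.
  rewrite -{1}evLt /p !comp_polyM.
  rewrite (orthonormal_parity evLt oPt) (orthonormal_parity evL oP).
  rewrite -raddfN/=; congr (Lt _).
  rewrite -scalerAl -!scalerAr scalerA exprS mulrCA -exprD addnn -mul2n exprM.
  by rewrite sqrrN !expr1n mulr1 scaleN1r.
by move=> ?; lra.
Qed.

End JacobiAlgebra.

(** * Integration of polynomials against a weight *)

Section WeightFunctional.
Context {R : realType}.
Notation mu := (@lebesgue_measure R).

Lemma poly_roots_seq (p : {poly R}) : p != 0 ->
  exists s : seq R, forall x, root p x -> x \in s.
Proof.
have [n] := ubnP (size p); elim: n p => // n IH p pn p0.
have [[x px]|nr] := pselect (exists x, root p x); last first.
  by exists [::] => x px; case: nr; exists x.
have /factor_theorem[r pE] := px.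
have r0 : r != 0 by apply: contraNneq p0 => r0; rewrite pE r0 mul0r.
have [|//|s rs] := IH r.
  by move: pn; rewrite pE size_Mmonic ?monicXsubC// size_XsubC; lia.
exists (x :: s) => y; rewrite pE rootM root_XsubC inE orbC => /orP[->//|/rs ->].
by rewrite orbT.
Qed.

(** A negligible set together with the roots of p cannot cover an interval. *)
Lemma itv_roots_negligible l u (p : {poly R}) (N : set R) : l < u ->
  p != 0 -> mu.-negligible N ->
  exists x, [/\ l < x < u, p.[x] != 0 & ~ N x].
Proof.
move=> lu p0 [B [mB B0 NB]]; have [s ps] := poly_roots_seq p0.
apply/not_existsP => nx.
have cs : countable [set` s] by apply/finite_set_countable/finite_seqP; exists s.
have ms : measurable [set` s].
  by apply: countable_measurable.
have sub : `]l, u[%classic `<=` B `|` [set` s].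
  move=> x /=; rewrite in_itv/= => xlu.
  have [sx|/negP nsx] := pselect (x \in s); first by right.
  left; apply: NB; apply: contrapT => Nx; apply: (nx x); split => //.
  by apply: contra nsx => px; apply: ps; rewrite /root.
have : (mu `]l, u[%classic <= mu (B `|` [set` s]))%E.
  by apply: le_measure => //; rewrite inE//; exact: measurableU.
rewrite leNgt lebesgue_measure_itv/= lte_fin lu.
rewrite (le_lt_trans (measureU2 mu mB ms))//.
rewrite [X in (X + _)%E]B0 [X in (_ + X)%E]countable_lebesgue_measure0// adde0.
by rewrite -EFinD lte_fin subr_gt0.
Qed.

Lemma poly_itv_eq0 l u (p : {poly R}) : l < u ->
  (forall x, l < x < u -> p.[x] = 0) -> p = 0.
Proof.
move=> lu p0; apply/eqP; apply: contrapT => /negP pn0.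
have [x [/p0 -> ]] := itv_roots_negligible lu pn0 (negligible_set0 mu).
by rewrite eqxx.
Qed.

Variables (l u : R) (w : R -> R).
Hypotheses (ltlu : l < u) (iw : weight_integrable l u w).

Lemma bounded_horner (p : {poly R}) : [bounded p.[x] | x in `[l, u]].
Proof.
have /compact_bounded[M [Mr HM]] : compact ((fun x => p.[x] : R^o) @` `[l, u]).
  apply: continuous_compact; last exact: segment_compact.
  by apply: continuous_subspaceT => x; exact: continuous_horner.
exists M; split=> // e Me x lux; apply: (HM e Me).
by exists x.
Qed.

Lemma poly_weight_integrable (p : {poly R}) :
  mu.-integrable `[l, u] (EFin \o (fun x => p.[x] * w x)).
Proof.
have mp : measurable_fun `[l, u] (horner p).
  apply: measurable_funTS; apply: continuous_measurable_fun.
  exact: continuous_horner.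
have -> : EFin \o (fun x => p.[x] * w x) = ((EFin \o horner p) \* (EFin \o w))%E.
  by apply/funext => x /=; rewrite EFinM.
apply: (@integrableMr _ _ R mu _ _ _ _ _ (bounded_horner p) iw) => //.
Qed.

Definition weight_int (p : {poly R}) : R := \int[mu]_(x in `[l, u]) (p.[x] * w x).

Lemma weight_int_linear : exists L : {scalar {poly R}}, L =1 weight_int.
Proof.
have lin : linear_for *%R weight_int.
  move=> c p q; rewrite /weight_int.
  rewrite -RintegralZl ?poly_weight_integrable//.
  rewrite -RintegralD ?poly_weight_integrable//.
    by apply: eq_Rintegral => x _; rewrite hornerD hornerZ mulrDl mulrA.
  rewrite [X in mu.-integrable _ X](_ : _ = EFin \o (fun x => (c *: p).[x] * w x)).
    exact: poly_weight_integrable.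
  by apply/funext => x /=; rewrite hornerZ mulrA.
pose lw := GRing.isLinear.Build R {poly R} R^o *%R weight_int lin.
pose L : {scalar {poly R}} := HB.pack weight_int lw.
by exists L.
Qed.

Hypotheses (w_ge0 : forall x, 0 <= w x) (w_gt0 : forall x, l < x < u -> 0 < w x).

(** If the integral were 0 then p^2 w would vanish almost everywhere, whereas w > 0
    inside the interval and p has finitely many roots. *)
Lemma weight_int_gt0 (p : {poly R}) : p != 0 -> 0 < weight_int (p * p).
Proof.
move=> p0; have f0 x : 0 <= (p * p).[x] * w x.
  by rewrite hornerM -expr2 mulr_ge0// sqr_ge0.
rewrite lt0r; apply/andP; split; last exact: Rintegral_ge0.
apply/eqP => int0; have ipw := poly_weight_integrable (p * p).
have mf : measurable_fun `[l, u] (EFin \o (fun x => (p * p).[x] * w x)).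
  by case/integrableP: ipw.
have : (\int[mu]_(x in `[l, u]) `|((p * p).[x] * w x)%:E| = 0)%E.
  under eq_integral do rewrite /= ger0_norm//.
  rewrite -[LHS]fineK ?[fine _]int0//.
  exact: integrable_fin_num ipw.
move/(ae_eq_integral_abs mu (measurable_itv _) mf)/(itv_roots_negligible ltlu p0).
move=> [x [xlu px]]; apply => /(_ _)/=; rewrite in_itv/=.
have [/ltW -> /ltW ->] := andP xlu => /(_ isT)/eqP.
by rewrite eqe mulf_eq0 (gt_eqF (w_gt0 xlu)) hornerM orbF mulf_eq0 orbb (negPf px).
Qed.

End WeightFunctional.

(** * The weights on the interval of x *)

Section Calculus.
Context {R : realType}.

Lemma is_derive_continuous (f : R -> R) (x df : R) :
  is_derive x (1 : R) f df -> {for x, continuous f}.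
Proof.
by move=> [fx _]; exact/differentiable_continuous/derivable1_diffP.
Qed.

(** The truncation makes the power continuous on the whole line, which gives the
    continuity of the weights up to the endpoints of the interval. *)
Lemma powR_pos_continuous (p : R) : 0 < p ->
  continuous (fun t : R => Num.max 0 t `^ p).
Proof.
move=> p0 t; have [t0|t0|->] := ltgtP t 0.
- have nt : \forall s \near t, 0 = Num.max 0 s `^ p.
    near=> s; have s0 : s < 0 by near: s; exact: lt_nbhsl.
    by rewrite max_l ?powR0 ?gt_eqF// ltW.
  rewrite /continuous_at max_l ?ltW// powR0 ?gt_eqF//.
  apply: cvg_trans; first exact: (near_eq_cvg nt).
  exact: cvg_cst.
- have nt : \forall s \near t, s `^ p = Num.max 0 s `^ p.
    near=> s; have s0 : 0 < s by near: s; exact: lt_nbhsr.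
    by rewrite max_r// ltW.
  rewrite /continuous_at max_r ?ltW//.
  apply: cvg_trans; first exact: (near_eq_cvg nt).
  exact: (is_derive_continuous (is_derive1_powR p t0)).
rewrite /continuous_at maxxx powR0 ?gt_eqF//; apply/cvgrPdist_lt => e e0.
have /cvgrPdist_lt/(_ e e0)[d /= d0 Hd] := powR_cvg0 p0.
exists d => //= s sd; have [s0|s0] := ltP 0 s.
  exact: Hd.
by rewrite powR0 ?gt_eqF// subrr normr0.
Unshelve. all: by end_near. Qed.

Lemma addr1_gt0 (x : R) : -1 < x -> 0 < x + 1.
Proof. by move=> x1; lra. Qed.

Lemma addr2_gt0 (x : R) : -1 < x -> 0 < x + 2.
Proof. by move=> x1; lra. Qed.

End Calculus.

Section KoornwinderWeight.
Context {R : realType}.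
Notation mu := (@lebesgue_measure R).
Variables (alpha beta : R) (eta : bool) (q : {poly R}).
Hypotheses (ltab : alpha < beta)
  (rho_gt0 : forall x, alpha < x < beta -> 0 < rho eta q x).

Local Notation rho := (rho eta q).
Local Notation rho2 := (rho2 eta q).
Local Notation rho_drho := (rho_drho eta q).
Local Notation wR := (wR alpha beta eta q).

Lemma q_gt0 x : 0 < rho x -> 0 < q.[x].
Proof. by rewrite /Defs.rho; case: (eta) => //; rewrite sqrtr_gt0. Qed.

(** Nonnegativity passes to the endpoints by continuity. *)
Lemma q_ge0 x : alpha <= x <= beta -> 0 <= q.[x].
Proof.
move=> /andP[ax xb]; rewrite leNgt; apply/negP => qx.
have nq : \forall y \near x, q.[y] < 0.
  exact: (cvgr_lt q.[x] (@continuous_horner _ q x)).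
suff [y [yab qy]] : exists y, alpha < y < beta /\ q.[y] < 0.
  by have := q_gt0 (rho_gt0 yab); rewrite ltNge ltW.
have [xb'|bx] := ltP x beta.
  near x^'+ => y; exists y; split.
    apply/andP; split; last by near: y; exact: nbhs_right_lt.
    by apply: le_lt_trans ax _; near: y; exact: nbhs_right_gt.
  by near: y; apply: cvg_within; exact: nq.
have ax' : alpha < x by rewrite (lt_le_trans ltab).
near x^'- => y; exists y; split.
  apply/andP; split; first by near: y; exact: nbhs_left_gt.
  by apply: lt_le_trans xb; near: y; exact: nbhs_left_lt.
by near: y; apply: cvg_within; exact: nq.
Unshelve. all: by end_near. Qed.

Lemma rho_sqr x : 0 <= q.[x] -> rho2.[x] = rho x ^+ 2.
Proof.
move=> q0; rewrite /Defs.rho /Defs.rho2; case: (eta); first by rewrite sqr_sqrtr.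
by rewrite horner_exp.
Qed.

Lemma rho_ge0 x : 0 <= q.[x] -> 0 <= rho x.
Proof. by move=> q0; rewrite /Defs.rho; case: (eta); rewrite ?sqrtr_ge0. Qed.

Lemma rho_continuous : continuous rho.
Proof.
move=> x; rewrite /Defs.rho; case: (eta); last exact: continuous_horner.
apply: (@continuous_comp _ _ _ (horner q) Num.sqrt); first exact: continuous_horner.
exact: sqrt_continuous.
Qed.

Lemma is_derive_rho x : 0 < rho x ->
  is_derive x (1 : R) rho (rho_drho.[x] / rho x).
Proof.
move=> r0; have qx := q_gt0 r0; move: r0.
rewrite /Defs.rho /Defs.rho_drho /Defs.rho2; case: (eta) => r0.
  apply: (is_derive_eq (is_derive1_comp (is_derive1_sqrt qx) (is_derive_poly q x))).
  rewrite hornerZ invfM; field.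
  by rewrite gt_eqF.
apply: (is_derive_eq (is_derive_poly q x)).
by rewrite hornerZ expr2 derivM hornerD !hornerM; field; rewrite gt_eqF.
Qed.

Lemma wR_ge0 a b s x : 0 <= wR a b s x.
Proof. by rewrite !mulr_ge0 ?powR_ge0. Qed.

Lemma wR_gt0 a b s x : alpha < x < beta -> 0 < wR a b s x.
Proof.
move=> xab; have /andP[ax xb] := xab.
by rewrite !mulr_gt0 ?powR_gt0 ?subr_gt0// rho_gt0.
Qed.

Definition endpoints : {poly R} := (beta%:P - 'X) * ('X - alpha%:P).

Lemma powRS (x p : R) : 0 <= x -> -1 < p -> x `^ (p + 1) = x * x `^ p.
Proof.
by move=> x0 p1; rewrite -[p in RHS](addrK 1) mulr_powRB1//; lra.
Qed.

Lemma wR_endpoints a b s x : -1 < a -> -1 < b -> alpha <= x <= beta ->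
  wR (a + 1) (b + 1) s x = endpoints.[x] * wR a b s x.
Proof.
move=> a1 b1 /andP[ax xb]; rewrite /Defs.wR !powRS ?subr_ge0// /endpoints.
by rewrite !(hornerM, hornerD, hornerN, hornerC, hornerX); ring.
Qed.

Lemma wR_rho a b s x : -1 < s -> alpha <= x <= beta ->
  wR a b (s + 1) x = rho x * wR a b s x.
Proof.
by move=> s1 xab; rewrite /Defs.wR powRS ?rho_ge0 ?q_ge0//; ring.
Qed.

Lemma wR_rho2 a b s x : -1 < s -> alpha <= x <= beta ->
  wR a b (s + 2) x = rho2.[x] * wR a b s x.
Proof.
move=> s1 xab; rewrite -[2]/(1 + 1 : R) addrA !wR_rho//; last by lra.
by rewrite rho_sqr ?q_ge0//; ring.
Qed.

Lemma wR_integrable_endpoints a b s : -1 < a -> -1 < b ->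
  weight_integrable alpha beta (wR a b s) ->
  weight_integrable alpha beta (wR (a + 1) (b + 1) s).
Proof.
move=> a1 b1 iw; apply: (eq_integrable _ _ _ _ (poly_weight_integrable iw endpoints)) => // x.
by rewrite inE/= in_itv/= => xab; rewrite /= wR_endpoints.
Qed.

Lemma wR_integrable_rho a b s : -1 < s ->
  weight_integrable alpha beta (wR a b s) ->
  weight_integrable alpha beta (wR a b (s + 1)).
Proof.
move=> s1 iw.
have mr : measurable_fun `[alpha, beta] rho.
  by apply: measurable_funTS; apply: continuous_measurable_fun; exact: rho_continuous.
have br : [bounded rho x | x in `[alpha, beta]].
  have /compact_bounded[M [Mr HM]] : compact ((fun x => rho x : R^o) @` `[alpha, beta]).
    apply: continuous_compact; last exact: segment_compact.
    by apply: continuous_subspaceT => x; exact: rho_continuous.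
  exists M; split=> // e Me x lux; apply: (HM e Me).
  by exists x.
have := @integrableMr _ _ R mu _ (measurable_itv _) _ _ mr br iw.
apply: eq_integrable => // x; rewrite inE/= in_itv/= => xab.
by rewrite /= wR_rho// EFinM.
Qed.

Section PearsonEquation.
Variables (a b s : R) (F : {poly R}).
Hypotheses (a1 : -1 < a) (b1 : -1 < b) (s1 : -1 < s).
Hypothesis iw : weight_integrable alpha beta (wR a b s).

(** The quotient X w'/w for w = (beta - x)^(a+1) (x - alpha)^(b+1). *)
Definition log_lin : {poly R} :=
  (b + 1) *: (beta%:P - 'X) - (a + 1) *: ('X - alpha%:P).

(** The quotient X rho^2 w'/w for w = (beta - x)^(a+1) (x - alpha)^(b+1) rho^(s+2):
    the factor rho^2 clears the denominator of rho'/rho = rho rho' / rho^2. *)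
Definition log_deriv : {poly R} :=
  log_lin * rho2 + (s + 2) *: (endpoints * rho_drho).

Lemma is_derive_wR x : alpha < x < beta ->
  is_derive x (1 : R) (fun y => F.[y] * wR (a + 1) (b + 1) (s + 2) y)
    ((F^`() * (endpoints * rho2) + F * log_deriv).[x] * wR a b s x).
Proof.
move=> xab; have /andP[ax xb] := xab; have r0 := rho_gt0 xab.
have db : is_derive x (1 : R) (fun y : R => beta - y) (-1).
  have := @is_derive_poly _ (beta%:P - 'X) x.
  rewrite derivB derivC derivX sub0r hornerN hornerC.
  by congr is_derive; apply/funext => y; rewrite !hornerE.
have da : is_derive x (1 : R) (fun y : R => y - alpha) 1.
  have := @is_derive_poly _ ('X - alpha%:P) x.
  rewrite derivB derivC derivX subr0 hornerC.
  by congr is_derive; apply/funext => y; rewrite !hornerE.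
have b0 : 0 < beta - x by rewrite subr_gt0.
have a0 : 0 < x - alpha by rewrite subr_gt0.
have Db := @is_derive1_comp _ (fun t => t `^ (a + 1)) (fun y => beta - y) x _ _
  (is_derive1_powR (a + 1) b0) db.
have Da := @is_derive1_comp _ (fun t => t `^ (b + 1)) (fun y => y - alpha) x _ _
  (is_derive1_powR (b + 1) a0) da.
have Dr := @is_derive1_comp _ (fun t => t `^ (s + 2)) rho x _ _
  (is_derive1_powR (s + 2) r0) (is_derive_rho r0).
have D := is_deriveM (is_derive_poly F x) (is_deriveM (is_deriveM Db Da) Dr).
apply: (is_derive_eq D); rewrite !fctE /= /GRing.scale/= /Defs.wR !addrK.
have -> : s + 2 - 1 = s + 1 by lra.
have -> : s + 2 = s + 1 + 1 by lra.
have s2 : -1 < s + 1 by rewrite (lt_trans s1)// ltrDl.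
rewrite !powRS ?(ltW b0) ?(ltW a0) ?(ltW r0)//.
rewrite /log_deriv /log_lin /endpoints.
rewrite !(hornerM, hornerD, hornerN, hornerC, hornerX, hornerZ) rho_sqr ?(ltW (q_gt0 r0))//.
by field; rewrite gt_eqF.
Qed.

Lemma wR_continuous_oo x : alpha < x < beta -> {for x, continuous (wR a b s)}.
Proof.
move=> xab; have /andP[ax xb] := xab; have r0 := rho_gt0 xab.
have b0 : 0 < beta - x by rewrite subr_gt0.
have a0 : 0 < x - alpha by rewrite subr_gt0.
apply: continuousM; first apply: continuousM.
- apply: (@continuous_comp _ _ _ (fun y => beta - y) (fun t => t `^ a)).
    by apply: continuousB; [exact: cvg_cst|exact: cvg_id].
  exact: is_derive_continuous (is_derive1_powR a b0).
- apply: (@continuous_comp _ _ _ (fun y => y - alpha) (fun t => t `^ b)).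
    by apply: continuousB; [exact: cvg_id|exact: cvg_cst].
  exact: is_derive_continuous (is_derive1_powR b a0).
apply: (@continuous_comp _ _ _ rho (fun t => t `^ s)); first exact: rho_continuous.
exact: is_derive_continuous (is_derive1_powR s r0).
Qed.

Lemma boundary_term_continuous :
  {within `[alpha, beta],
    continuous (fun y => F.[y] * wR (a + 1) (b + 1) (s + 2) y)}.
Proof.
pose G y := F.[y] * (Num.max 0 (beta - y) `^ (a + 1) *
  Num.max 0 (y - alpha) `^ (b + 1) * Num.max 0 (rho y) `^ (s + 2)).
apply: (@subspace_eq_continuous _ _ _ G).
  move=> y; rewrite inE/= in_itv/= => yab; have /andP[ay yb] := yab.
  by rewrite /G /Defs.wR !max_r ?subr_ge0// rho_ge0// q_ge0.
apply: continuous_subspaceT => y.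
apply: continuousM; first exact: continuous_horner.
apply: continuousM; first apply: continuousM.
- apply: (@continuous_comp _ _ _ (fun y => beta - y) (fun t => Num.max 0 t `^ (a + 1))).
    by apply: continuousB; [exact: cvg_cst|exact: cvg_id].
  by apply: powR_pos_continuous; exact: addr1_gt0.
- apply: (@continuous_comp _ _ _ (fun y => y - alpha) (fun t => Num.max 0 t `^ (b + 1))).
    by apply: continuousB; [exact: cvg_id|exact: cvg_cst].
  by apply: powR_pos_continuous; exact: addr1_gt0.
apply: (@continuous_comp _ _ _ rho (fun t => Num.max 0 t `^ (s + 2))).
  exact: rho_continuous.
by apply: powR_pos_continuous; exact: addr2_gt0.
Qed.

(** The integrand is the derivative of F times the weight (a+1,b+1,s+2) inside the
    interval, and that product vanishes at the endpoints.  The integrand may be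
    unbounded near the endpoints, so the mean value theorem is applied to the
    difference of the product and of the indefinite integral, both continuous on
    the closed interval. *)
Lemma pearson_wR : weight_int alpha beta (wR a b s)
  (F^`() * (endpoints * rho2) + F * log_deriv) = 0.
Proof.
set p := _ + _; pose h x := p.[x] * wR a b s x.
have ih : mu.-integrable `[alpha, beta] (EFin \o h) by exact: poly_weight_integrable.
pose Phi x := parameterized_integral mu alpha x h.
pose g x := F.[x] * wR (a + 1) (b + 1) (s + 2) x.
have gc := boundary_term_continuous; rewrite -/g in gc.
have Pc := parameterized_integral_continuous (ltW ltab) ih.
have [|x|c _] := @MVT _ (fun x => Phi x - g x) (fun=> 0) _ _ ltab.
- move=> x; rewrite in_itv/= => xab; have /andP[ax xb] := xab.
  have hc : {for x, continuous h}.
    by apply: continuousM; [exact: continuous_horner|exact: wR_continuous_oo].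
  have [dP PE] := continuous_FTC1_closed xb ih ax hc.
  have dg := is_derive_wR xab.
  have dPhi : is_derive x 1 Phi (h x) by apply: DeriveDef; [exact: dP|rewrite -derive1E; exact: PE].
  by have := is_deriveB dPhi dg; rewrite subrr.
- by apply: continuousB; [exact: Pc|exact: gc].
rewrite mul0r /g /Defs.wR !subrr !powR0 ?gt_eqF ?addr1_gt0//.
rewrite !(mul0r, mulr0, subr0).
rewrite {2}/Phi /parameterized_integral set_itv1 Rintegral_set1 subr0.
exact.
Qed.

End PearsonEquation.

End KoornwinderWeight.

(** * The three matrices of the derivative formula *)

Lemma opoly_orthonormal (R : realType) (l u : R) (w : R -> R) : l < u ->
  weight_integrable l u w -> (forall x, 0 <= w x) ->
  (forall x, l < x < u -> 0 < w x) ->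
  exists L : {scalar {poly R}},
    L =1 weight_int l u w /\ orthonormal L (opoly l u w).
Proof.
move=> lu iw w0 w1; have [L LE] := weight_int_linear iw; exists L; split=> //.
have intE P m n : L (P m * P n) = \int[@lebesgue_measure R]_(x in `[l, u])
    ((P m).[x] * (P n).[x] * w x).
  by rewrite LE; apply: eq_Rintegral => x _; rewrite hornerM.
have orthE P : orthonormal L P <-> orthonormal_polys l u w P.
  by split=> -[gP lP oP]; split=> // m n; move: (oP m n); rewrite intE.
have [|P /orthE oP] := @gram_schmidt _ L.
  by move=> p p0; rewrite LE weight_int_gt0.
by apply/orthE; rewrite /opoly; case: xgetP => [Q -> //|/(_ P)].
Qed.

(** This makes the results on wR, with rho = 1, available for the Jacobi weight. *)
Lemma wP_wR (R : realType) (gamma delta d c s : R) :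
  wP gamma delta d c = wR gamma delta false 1 d c s.
Proof.
by apply/funext => y; rewrite /wP /wR /rho/= hornerC powR1 mulr1.
Qed.

(* From here on the weights and the connection matrices are known through the
   lemmas above only. *)
Opaque opoly conn_mx imx_inv imx_mul imx_horner row_mul wR.

Section KoornwinderMatrices.
Context {R : realType}.
Variables (alpha beta : R) (eta : bool) (q : {poly R}) (a b : R).
Hypotheses (ltab : alpha < beta) (a1 : -1 < a) (b1 : -1 < b)
  (rho_gt0 : forall x, alpha < x < beta -> 0 < rho eta q x)
  (q_size : (2 < size q)%N).

Local Notation rho := (rho eta q).
Local Notation rho2 := (rho2 eta q).
Local Notation rho_drho := (rho_drho eta q).
Local Notation wR := (wR alpha beta eta q).
Local Notation Rn := (Rn alpha beta eta q).
Local Notation raiseR := (raiseR alpha beta eta q).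
Local Notation diffR := (diffR alpha beta eta q).
Local Notation jacobiR := (jacobiR alpha beta eta q).
Local Notation integrable a b s := (weight_integrable alpha beta (wR a b s)).
Local Notation X := (endpoints alpha beta).
Local Notation wint a b s := (weight_int alpha beta (wR a b s)).

Lemma Rn_orthonormal a' b' s : integrable a' b' s ->
  exists L : {scalar {poly R}}, L =1 wint a' b' s /\ orthonormal L (Rn a' b' s).
Proof.
move=> iw; apply: opoly_orthonormal => // [x|x xab]; first exact: wR_ge0.
exact: wR_gt0.
Qed.

Lemma Rn_graded a' b' s : integrable a' b' s -> graded (Rn a' b' s).
Proof. by move=> /Rn_orthonormal[L [_ []]]. Qed.

Lemma wint_endpoints s p : wint (a + 1) (b + 1) s p = wint a b s (X * p).
Proof.
rewrite /weight_int; apply: eq_Rintegral => x; rewrite inE/= in_itv/= => xab.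
by rewrite wR_endpoints// (hornerM X p) mulrCA mulrA.
Qed.

Lemma wint_rho2 s p : -1 < s -> wint a b (s + 2) p = wint a b s (rho2 * p).
Proof.
move=> s1; rewrite /weight_int; apply: eq_Rintegral => x; rewrite inE/= in_itv/= => xab.
by rewrite (wR_rho2 ltab rho_gt0)// (hornerM rho2 p) mulrCA mulrA.
Qed.

Lemma integrable_rho s : -1 < s -> integrable a b s -> integrable a b (s + 1).
Proof. by move=> s1; exact: wR_integrable_rho. Qed.

Lemma integrable_endpoints s : integrable a b s -> integrable (a + 1) (b + 1) s.
Proof. exact: wR_integrable_endpoints. Qed.

Let deg2 := (size rho2).-1.

Lemma size_endpoints : (size X <= 3)%N.
Proof.
have sX : (size (- 'X : {poly R}) <= 2)%N by rewrite size_polyN size_polyX.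
apply: sizeM_le (_ : _ <= 2)%N (_ : _ <= 2)%N; apply: sizeD_le => //.
- by rewrite (leq_trans (size_polyC_leq1 _)).
- by rewrite size_polyX.
- by rewrite size_polyN (leq_trans (size_polyC_leq1 _)).
Qed.

Lemma size_log_lin : (size (log_lin alpha beta a b) <= 2)%N.
Proof.
have sC (c : R) : (size c%:P <= 2)%N by rewrite (leq_trans (size_polyC_leq1 _)).
apply: sizeD_le; [|apply: sizeN_le]; apply: sizeZ_le; apply: sizeD_le => //.
- by rewrite size_polyN size_polyX.
- by rewrite size_polyX.
- by rewrite size_polyN.
Qed.

Lemma size_rho_drho : (size rho_drho <= deg2)%N.
Proof. by apply: sizeZ_le; exact: size_deriv_le (leqnn _). Qed.

Lemma deg2_gt0 : (1 < deg2)%N.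
Proof.
have q0 : q != 0 by rewrite -size_poly_gt0 (leq_trans _ q_size).
rewrite /deg2 /Defs.rho2; case: (eta); first by move: q_size; case: (size q).
rewrite expr2 size_mul//; move: q_size; case: (size q) => [|[|[|k]]]//= _.
by rewrite addnS.
Qed.

Lemma eta01 : eta%:R = 0 :> R \/ eta%:R = 1 :> R.
Proof. by case: (eta); [right|left]. Qed.

Lemma size_rho2 : (size rho2 <= deg2.+1)%N.
Proof. exact: leqSpred. Qed.

(** Lower band: R_j' is paired with X rho^2 times the i-th element of the basis,
    and integration by parts leaves R_j against a polynomial of degree at most
    i + deg rho^2 + 1. *)
Lemma deriv_matrix s s1 s2 :
  -1 < s -> integrable a b s -> s1 = s + 1 + eta%:R -> s2 = s + 2 ->
  let M := imx_mul (raiseR (a + 1) (b + 1) s1 (a + 1) (b + 1) s2) (diffR a b s) in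
  [/\ graded (Rn (a + 1) (b + 1) s2), colfinite M,
      row_mul (Rn (a + 1) (b + 1) s2) M = (fun j => (Rn a b s j)^`()) &
      forall i j, (j <= i)%N || (i + deg2 + 1 < j)%N -> M i j = 0].
Proof.
move=> sN1 iw -> -> /=; have s1N1 : -1 < s + 1 by lra.
have iw1 : integrable a b (s + 1) by exact: integrable_rho.
have iw2 : integrable a b (s + 2).
  have -> : s + 2 = s + 1 + 1 by lra.
  exact: integrable_rho.
have iweta : integrable a b (s + 1 + eta%:R).
  have [->|->] := eta01; rewrite ?addr0//; exact: integrable_rho.
have [L [LE oR]] := Rn_orthonormal iw.
have [L1 [L1E oR1]] := Rn_orthonormal (integrable_endpoints iw2).
have gR := Rn_graded (integrable_endpoints iw2).
have geta := Rn_graded (integrable_endpoints iweta).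
set T := raiseR _ _ _ _ _ _; set D := diffR a b s; set Q := Rn (a + 1) (b + 1) (s + 2).
have fT : colfinite T by exact: colfinite_conn.
have fD : colfinite D by exact: colfinite_conn.
have fM : colfinite (imx_mul T D) by exact: colfinite_mul.
have ME : row_mul Q (imx_mul T D) = fun j => (Rn a b s j)^`().
  rewrite (row_mul_mul Q fT fD).
  have -> : row_mul Q T = Rn (a + 1) (b + 1) (s + 1 + eta%:R) := row_mul_conn _ gR.
  exact: row_mul_conn _ geta.
have gRs : graded (Rn a b s) by case: oR.
split; [exact: gR|exact: fM|exact: ME|move=> i j /orP[ji|ij]].
  apply: (row_mul_size (n := j) gR fM); rewrite ME.
  by apply: leq_trans (size_deriv_le (eq_leq (gRs j))) _.
rewrite (orthonormal_coef _ _ oR1 fM) ME.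
have -> : L1 (Q i * (Rn a b s j)^`()) = L ((X * rho2) * (Q i * (Rn a b s j)^`())).
  by rewrite L1E LE wint_endpoints wint_rho2// mulrA [rho2 * X]mulrC.
have pL : pearson L (X * rho2) (log_deriv alpha beta eta q a b s).
  by move=> F; rewrite LE pearson_wR.
rewrite (pearson_parts _ _ pL) (orthonormal_low oR) ?oppr0//.
have sQ := eq_leq (gR i); have sr := size_rho2; have sd := size_rho_drho.
have sX := size_endpoints; have sl := size_log_lin.
have d2 := deg2_gt0.
apply: leq_trans (_ : _ <= i + deg2 + 2)%N _; last by lia.
apply: sizeD_le.
  by apply: leq_trans (sizeM_le (size_deriv_le sQ) (sizeM_le sX sr)) _; lia.
apply: leq_trans (sizeM_le sQ (_ : _ <= deg2 + 2)%N) _; last by lia.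
apply: sizeD_le; first by apply: leq_trans (sizeM_le sl sr) _; lia.
by apply: sizeZ_le; apply: leq_trans (sizeM_le sX sd) _; lia.
Qed.

Definition lower2_mx (s kappa sigma s3 t : R) : imx R :=
  let J := jacobiR (a + 1) (b + 1) sigma in
  fun i j =>
    - s * (imx_horner rho2 J *m diffR a b s3 *m (raiseR a b s3 a b t)^-1)%IM i j
    - kappa * (imx_horner rho_drho J *m raiseR a b sigma (a + 1) (b + 1) sigma
                 *m (raiseR a b sigma a b t)^-1)%IM i j.

(** Lower band: integrating by parts with the weight of exponent sigma makes the
    term in rho rho' appear with the factor s (sigma + 2), and kappa is the value
    that cancels it.  What remains is divisible by rho^2, which is absorbed by
    the weight of exponent sigma + 2, for which Rn a b t is orthogonal. *)
Lemma lower2_matrix (s kappa sigma s3 t : R) :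
  -1 < s3 -> integrable a b s3 -> sigma = s3 + 1 + eta%:R -> t = sigma + 2 ->
  kappa = s * t ->
  let M := lower2_mx s kappa sigma s3 t in
  [/\ graded (Rn (a + 1) (b + 1) sigma), colfinite M,
      row_mul (Rn (a + 1) (b + 1) sigma) M = (fun j =>
        - s *: (rho2 * (Rn a b t j)^`()) - kappa *: (rho_drho * Rn a b t j)) &
      forall i j, (j + deg2 <= i)%N || (i + 1 < j)%N -> M i j = 0].
Proof.
move=> s3N1 iw3 sE tE kE M; pose J := jacobiR (a + 1) (b + 1) sigma.
have s4 : -1 < s3 + 1 by lra.
have iw4 : integrable a b (s3 + 1) by exact: integrable_rho.
have sN1 : -1 < sigma by rewrite sE; have [->|->] := eta01; lra.
have iws : integrable a b sigma.
  by rewrite sE; have [->|->] := eta01; rewrite ?addr0//; exact: integrable_rho.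
have iws1 : integrable a b (sigma + 1) by exact: integrable_rho.
have iwt : integrable a b t.
  have -> : t = sigma + 1 + 1 by lra.
  by apply: integrable_rho => //; lra.
have g3 := Rn_graded iw3; have gs := Rn_graded iws; have gt := Rn_graded iwt.
have gQ := Rn_graded (integrable_endpoints iws).
set Q := Rn (a + 1) (b + 1) sigma in gQ *.
have fJ : colfinite J by exact: colfinite_conn.
have [fi3 Ei3] := conn_mx_inv gt g3; have [fis Eis] := conn_mx_inv gt gs.
rewrite -/(raiseR a b s3 a b t) in fi3 Ei3.
rewrite -/(raiseR a b sigma a b t) in fis Eis.
have fh f : colfinite (imx_horner f J) by exact: colfinite_horner.
have Eh f : row_mul Q (imx_horner f J) = fun j => f * Q j by exact: row_mul_horner.
have fd : colfinite (diffR a b s3).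
  by apply: colfinite_conn; rewrite -sE.
have Ed : row_mul Q (diffR a b s3) = fun j => (Rn a b s3 j)^`().
  by rewrite /Defs.diffR -sE row_mul_conn.
have fr : colfinite (raiseR a b sigma (a + 1) (b + 1) sigma) by exact: colfinite_conn.
have Er : row_mul Q (raiseR a b sigma (a + 1) (b + 1) sigma) = Rn a b sigma.
  exact: row_mul_conn.
pose M1 := (imx_horner rho2 J *m diffR a b s3 *m (raiseR a b s3 a b t)^-1)%IM.
pose M2 := (imx_horner rho_drho J *m raiseR a b sigma (a + 1) (b + 1) sigma
                 *m (raiseR a b sigma a b t)^-1)%IM.
have MM : M = fun i j => - s * M1 i j - kappa * M2 i j by [].
have f1 : colfinite M1 by exact: colfinite_mul (colfinite_mul (fh _) _) _.
have f2 : colfinite M2 by exact: colfinite_mul (colfinite_mul (fh _) _) _.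
have E1 : row_mul Q M1 = fun j => rho2 * (Rn a b t j)^`().
  rewrite (row_mul_mul Q (colfinite_mul (fh rho2) fd) fi3) (row_mul_mul Q (fh rho2) fd).
  rewrite Eh (row_mul_scale _ _ fd) Ed (row_mul_scale _ _ fi3).
  apply/funext => j; congr (_ * _).
  have [N iN] := fi3 j; rewrite -[Rn a b t in RHS]Ei3 !(row_mulE _ iN) raddf_sum/=.
  by apply: eq_bigr => i _; rewrite derivZ.
have E2 : row_mul Q M2 = fun j => rho_drho * Rn a b t j.
  rewrite (row_mul_mul Q (colfinite_mul (fh rho_drho) fr) fis).
  rewrite (row_mul_mul Q (fh rho_drho) fr) Eh (row_mul_scale _ _ fr) Er.
  by rewrite (row_mul_scale _ _ fis) Eis.
(* From here on M1 and M2 are known through E1 and E2 only. *)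
clearbody M M1 M2.
have [fM ME] := row_mul_lin Q (- s) (- kappa) f1 f2.
have {}fM : colfinite M.
  by move=> j; have [N HN] := fM j; exists N => i /HN; rewrite MM -(mulNr kappa).
have {}ME : row_mul Q M = fun j =>
    - s *: (rho2 * (Rn a b t j)^`()) - kappa *: (rho_drho * Rn a b t j).
  have -> : M = fun i j => - s * M1 i j + - kappa * M2 i j.
    by apply/funext => i; apply/funext => j; rewrite MM -(mulNr kappa).
  rewrite ME. rewrite E1. rewrite E2. apply/funext => j. rewrite (scaleNr kappa). by [].
have d2 := deg2_gt0; have sr := size_rho2; have sd := size_rho_drho.
split; [exact: gQ|exact: fM|exact: ME|move=> i j /orP[ji|ij]].
  apply: (row_mul_size (n := j) gQ fM); rewrite ME.
  apply: leq_trans ji; apply: sizeD_le; [|apply: sizeN_le]; apply: sizeZ_le.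
    by apply: leq_trans (sizeM_le sr (size_deriv_le (eq_leq (gt j)))) _; lia.
  by apply: leq_trans (sizeM_le sd (eq_leq (gt j))) _; lia.
have [L [LE oR]] := Rn_orthonormal iws.
have [L1 [L1E oR1]] := Rn_orthonormal (integrable_endpoints iws).
have [Lt [LtE oRt]] := Rn_orthonormal iwt.
rewrite (orthonormal_coef _ _ oR1 fM) ME -/Q.
have pL : pearson L (X * rho2) (log_deriv alpha beta eta q a b sigma).
  by move=> F; rewrite LE pearson_wR.
have LX p : L1 p = L (X * p) by rewrite L1E LE wint_endpoints.
have LR p : Lt p = L (rho2 * p) by rewrite LtE LE tE wint_rho2.
set f := Q i; set g := Rn a b t j.
have -> : L1 (f * (- s *: (rho2 * g^`()) - kappa *: (rho_drho * g))) =
    - s * L (X * rho2 * (f * g^`())) - kappa * L (X * rho_drho * f * g).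
  rewrite LX -!linearZ/= -raddfB/=; congr (L _).
  by rewrite -!mul_polyC; ring.
have low : Lt ((f^`() * X + f * log_lin alpha beta a b) * g) = 0.
  rewrite (orthonormal_low oRt)//.
  have sQ := eq_leq (gQ i); have sX := size_endpoints; have sl := size_log_lin.
  apply: leq_trans (_ : _ <= i.+2)%N _; last by lia.
  apply: sizeD_le; last by apply: leq_trans (sizeM_le sQ sl) _; lia.
  by apply: leq_trans (sizeM_le (size_deriv_le sQ) sX) _; lia.
have LE2 : L ((f^`() * (X * rho2) + f * log_deriv alpha beta eta q a b sigma) * g) =
    (sigma + 2) * L (X * rho_drho * f * g).
  rewrite -linearZ/= -[RHS]add0r -low LR -raddfD/=; congr (L _).
  by rewrite /log_deriv -!mul_polyC; ring.
by rewrite (pearson_parts _ _ pL) LE2 kE tE; ring.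
Qed.

End KoornwinderMatrices.

Section PolynomialRho.
Context {R : realType}.
Variables (alpha beta : R) (q : {poly R}) (a b : R).
Hypotheses (ltab : alpha < beta) (a1 : -1 < a) (b1 : -1 < b)
  (rho_gt0 : forall x, alpha < x < beta -> 0 < rho false q x)
  (q_size : (2 < size q)%N).

Local Notation wR := (wR alpha beta false q).
Local Notation Rn := (Rn alpha beta false q).
Local Notation raiseR := (raiseR alpha beta false q).
Local Notation diffR := (diffR alpha beta false q).
Local Notation jacobiR := (jacobiR alpha beta false q).
Local Notation integrable a b s := (weight_integrable alpha beta (wR a b s)).
Local Notation X := (endpoints alpha beta).
Local Notation wint a b s := (weight_int alpha beta (wR a b s)).

Lemma wint_rho s p : -1 < s -> wint a b (s + 1) p = wint a b s (q * p).
Proof.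
move=> s1; rewrite /weight_int; apply: eq_Rintegral => x.
rewrite inE/= in_itv/= => xab.
by rewrite (wR_rho ltab rho_gt0)// (hornerM q p) mulrCA mulrA.
Qed.

Definition lower1_mx (t kappa tau tau1 : R) : imx R :=
  let J := jacobiR (a + 1) (b + 1) tau1 in
  fun i j =>
    - t * (imx_horner q J *m diffR a b tau *m (raiseR a b tau a b tau1)^-1)%IM i j
    - kappa * (imx_horner q^`() J *m raiseR a b tau1 (a + 1) (b + 1) tau1)%IM i j.

(** Here everything left by the integration by parts is divisible by rho, which is
    absorbed by the weight of exponent tau + 1; this holds for every kappa. *)
Lemma lower1_matrix (t kappa tau tau1 : R) :
  -1 < tau -> integrable a b tau -> tau1 = tau + 1 ->
  let M := lower1_mx t kappa tau tau1 in
  [/\ graded (Rn (a + 1) (b + 1) tau1), colfinite M,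
      row_mul (Rn (a + 1) (b + 1) tau1) M = (fun j =>
        - t *: (q * (Rn a b tau1 j)^`()) - kappa *: (q^`() * Rn a b tau1 j)) &
      forall i j, (j + (size q).-1 <= i)%N || (i + (size q).-1 + 1 < j)%N ->
        M i j = 0].
Proof.
move=> tN1 iw tE M; pose J := jacobiR (a + 1) (b + 1) tau1.
have iw1 : integrable a b tau1.
  by rewrite tE; exact: (integrable_rho ltab rho_gt0 tN1 iw).
have iQ : integrable (a + 1) (b + 1) tau1 by exact: integrable_endpoints.
have gt := Rn_graded ltab rho_gt0 iw; have g1 := Rn_graded ltab rho_gt0 iw1.
have gQ := Rn_graded ltab rho_gt0 iQ.
set Q := Rn (a + 1) (b + 1) tau1 in gQ *.
have fJ : colfinite J by exact: colfinite_conn.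
have [fi Ei] := conn_mx_inv g1 gt.
rewrite -/(raiseR a b tau a b tau1) in fi Ei.
have fh f : colfinite (imx_horner f J) by exact: colfinite_horner.
have Eh f : row_mul Q (imx_horner f J) = fun j => f * Q j by exact: row_mul_horner.
have tau1E : tau + 1 + false%:R = tau1 by rewrite addr0.
have fd : colfinite (diffR a b tau).
  by apply: colfinite_conn; rewrite tau1E.
have Ed : row_mul Q (diffR a b tau) = fun j => (Rn a b tau j)^`().
  by rewrite /Defs.diffR tau1E row_mul_conn.
have fr : colfinite (raiseR a b tau1 (a + 1) (b + 1) tau1) by exact: colfinite_conn.
have Er : row_mul Q (raiseR a b tau1 (a + 1) (b + 1) tau1) = Rn a b tau1.
  exact: row_mul_conn.
pose M1 := (imx_horner q J *m diffR a b tau *m (raiseR a b tau a b tau1)^-1)%IM.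
pose M2 := (imx_horner q^`() J *m raiseR a b tau1 (a + 1) (b + 1) tau1)%IM.
have MM : M = fun i j => - t * M1 i j - kappa * M2 i j by [].
have f1 : colfinite M1 by exact: colfinite_mul (colfinite_mul (fh _) _) _.
have f2 : colfinite M2 by exact: colfinite_mul (fh _) _.
have E1 : row_mul Q M1 = fun j => q * (Rn a b tau1 j)^`().
  rewrite (row_mul_mul Q (colfinite_mul (fh q) fd) fi) (row_mul_mul Q (fh q) fd).
  rewrite Eh (row_mul_scale _ _ fd) Ed (row_mul_scale _ _ fi).
  apply/funext => j; congr (_ * _).
  have [N iN] := fi j; rewrite -[Rn a b tau1 in RHS]Ei !(row_mulE _ iN) raddf_sum/=.
  by apply: eq_bigr => i _; rewrite derivZ.
have E2 : row_mul Q M2 = fun j => q^`() * Rn a b tau1 j.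
  by rewrite (row_mul_mul Q (fh q^`()) fr) Eh (row_mul_scale _ _ fr) Er.
clearbody M M1 M2.
have [fM ME] := row_mul_lin Q (- t) (- kappa) f1 f2.
have {}fM : colfinite M.
  by move=> j; have [N HN] := fM j; exists N => i /HN; rewrite MM -(mulNr kappa).
have {}ME : row_mul Q M = fun j =>
    - t *: (q * (Rn a b tau1 j)^`()) - kappa *: (q^`() * Rn a b tau1 j).
  have -> : M = fun i j => - t * M1 i j + - kappa * M2 i j.
    by apply/funext => i; apply/funext => j; rewrite MM -(mulNr kappa).
  by rewrite ME E1 E2; apply/funext => j; rewrite (scaleNr kappa).
have sq : (size q <= (size q).-1.+1)%N by exact: leqSpred.
have sd := size_deriv_le (leqnn (size q)).
split; [exact: gQ|exact: fM|exact: ME|move=> i j /orP[ji|ij]].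
  apply: (row_mul_size (n := j) gQ fM); rewrite ME.
  apply: leq_trans ji; apply: sizeD_le; [|apply: sizeN_le]; apply: sizeZ_le.
    by apply: leq_trans (sizeM_le sq (size_deriv_le (eq_leq (g1 j)))) _; lia.
  by apply: leq_trans (sizeM_le sd (eq_leq (g1 j))) _; lia.
have [L [LE oR]] := Rn_orthonormal ltab rho_gt0 iw.
have [L1 [L1E oR1]] := Rn_orthonormal ltab rho_gt0 iQ.
have [Lt [LtE oRt]] := Rn_orthonormal ltab rho_gt0 iw1.
rewrite (orthonormal_coef _ _ oR1 fM) ME -/Q.
have pL : pearson L (X * rho2 false q) (log_deriv alpha beta false q a b tau).
  by move=> F; rewrite LE (pearson_wR ltab rho_gt0).
have LR p : Lt p = L (q * p) by rewrite LtE LE tE wint_rho.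
have LX p : L1 p = Lt (X * p) by rewrite L1E LtE wint_endpoints//.
have rdE : rho_drho false q = q * q^`().
  rewrite /rho_drho /rho2 expr2 derivM [q^`() * q]mulrC scalerDr -scalerDl.
  have -> : 2^-1 + 2^-1 = 1 :> R by lra.
  by rewrite scale1r.
set f := Q i; set g := Rn a b tau1 j.
pose h := t *: ((f^`() * X + f * log_lin alpha beta a b) * q
             + (tau + 2) *: (X * q^`() * f)) - kappa *: (X * q^`() * f).
have -> : L1 (f * (- t *: (q * g^`()) - kappa *: (q^`() * g))) = Lt (h * g).
  transitivity (- t * L (X * rho2 false q * (f * g^`()))
     - kappa * L (X * (q * q^`()) * f * g)).
    rewrite LX LR -!linearZ/= -raddfB/=; congr (L _).
    by rewrite /rho2 -!mul_polyC; ring.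
  rewrite (pearson_parts _ _ pL) LR mulrNN -!linearZ/= -raddfB/=; congr (L _).
  by rewrite /h /log_deriv rdE /rho2 -!mul_polyC; ring.
rewrite (orthonormal_low oRt)//.
have sQ := eq_leq (gQ i); have sX := size_endpoints alpha beta.
have sl := size_log_lin alpha beta a b.
apply: leq_trans (_ : _ <= i + (size q).-1 + 2)%N _; last by lia.
have sXq : (size (X * q^`() * f)%R <= i + (size q).-1 + 2)%N.
  by apply: leq_trans (sizeM_le (sizeM_le sX sd) sQ) _; lia.
apply: sizeD_le; [|apply: sizeN_le]; apply: sizeZ_le => //.
apply: sizeD_le; last exact: sizeZ_le.
apply: leq_trans (sizeM_le (_ : _ <= i.+2)%N sq) _; last by lia.
apply: sizeD_le; last by apply: leq_trans (sizeM_le sQ sl) _; lia.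
by apply: leq_trans (sizeM_le (size_deriv_le sQ) sX) _; lia.
Qed.

End PolynomialRho.

(** * Jacobi polynomials in the transverse variable *)

Section JacobiWeight.
Context {R : realType}.
Variables (gamma delta d c : R).
Hypotheses (ltgd : gamma < delta) (d1 : -1 < d) (c1 : -1 < c).
Hypothesis iw : weight_integrable gamma delta (wP gamma delta d c).

Local Notation X := (endpoints gamma delta).
Local Notation B := (log_lin gamma delta d c).

Lemma rho1_gt0 x : gamma < x < delta -> 0 < rho false (1 : {poly R}) x.
Proof. by rewrite /rho/= hornerC ltr01. Qed.

Lemma wP_functionals : exists L Lt : {scalar {poly R}},
  [/\ orthonormal L (Pn gamma delta d c),
      orthonormal Lt (Pn gamma delta (d + 1) (c + 1)),
      forall p, Lt p = L (X * p), pearson L X B &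
      pearson Lt X (log_lin gamma delta (d + 1) (c + 1))].
Proof.
have rg := rho1_gt0.
have z1 : -1 < 0 :> R by rewrite oppr_lt0.
have iw0 : weight_integrable gamma delta (wR gamma delta false 1 d c 0).
  by rewrite -(wP_wR _ _ _ _ 0).
have iw1 := integrable_endpoints d1 c1 iw0.
have [L [LE oL]] := Rn_orthonormal ltgd rg iw0.
have [Lt [LtE oLt]] := Rn_orthonormal ltgd rg iw1.
have rhoE : rho2 false (1 : {poly R}) = 1 by rewrite /rho2 expr1n.
have logE d' c' : log_deriv gamma delta false 1 d' c' 0 = log_lin gamma delta d' c'.
  rewrite /log_deriv rhoE mulr1 /rho_drho rhoE derivC scaler0 mulr0 scaler0.
  by rewrite addr0.
exists L, Lt; split.
- by rewrite /Pn (wP_wR _ _ _ _ 0); exact: oL.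
- by rewrite /Pn (wP_wR _ _ _ _ 0); exact: oLt.
- by move=> p; rewrite LE LtE wint_endpoints.
- move=> F; have := pearson_wR ltgd rg F d1 c1 z1 iw0.
  rewrite rhoE mulr1 logE -LE; exact.
- have d2 : -1 < d + 1 by rewrite (lt_trans d1)// ltrDl.
  have c2 : -1 < c + 1 by rewrite (lt_trans c1)// ltrDl.
  move=> F; have := pearson_wR ltgd rg F d2 c2 z1 iw1.
  rewrite rhoE mulr1 logE -LtE; exact.
Qed.

Lemma log_lin_lead : (size (B * 'X - (d + c + 2) *: X)%R <= 2)%N.
Proof.
have -> : B * 'X - (d + c + 2) *: X =
    ((c + 1) * delta + (d + 1) * gamma - (d + c + 2) * (delta + gamma)) *: 'X
    + ((d + c + 2) * delta * gamma)%:P.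
  by rewrite /log_lin /endpoints -!mul_polyC; ring.
apply: sizeD_le; first by rewrite sizeZ_le// size_polyX.
by rewrite (leq_trans (size_polyC_leq1 _)).
Qed.

End JacobiWeight.

(** The Pearson equation for the even powers of the variable is a two-term
    recursion on the odd moments. *)
Lemma symmetric_odd_moments (R : realType) (delta c : R) (L : {scalar {poly R}}) :
  -1 < c -> pearson L (endpoints (- delta) delta) (log_lin (- delta) delta c c) ->
  forall j, L 'X^(j.*2.+1) = 0.
Proof.
move=> c1 pL.
have XE : endpoints (- delta) delta = (delta ^+ 2)%:P - 'X^2.
  by rewrite /endpoints; ring.
have BE : log_lin (- delta) delta c c = - (2 * (c + 1)) *: 'X.
  by rewrite /log_lin -!mul_polyC; ring.
have c0 : 0 < 2 * (c + 1) by lra.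
elim=> [|j IH].
  have := pL 1; rewrite derivC mul0r mul1r add0r BE linearZ/= => /eqP.
  by rewrite mulf_eq0 oppr_eq0 gt_eqF//= => /eqP.
have := pL 'X^(j.+1.*2); rewrite derivXn XE BE.
have -> : 'X^(j.+1.*2.-1) *+ j.+1.*2 * ((delta ^+ 2)%:P - 'X^2)
    + 'X^(j.+1.*2) * (- (2 * (c + 1)) *: 'X) =
    (j.+1.*2%:R * delta ^+ 2) *: 'X^(j.*2.+1)
    - (j.+1.*2%:R + 2 * (c + 1)) *: 'X^(j.+1.*2.+1) :> {poly R}.
  rewrite doubleS/= -mulr_natr -!mul_polyC.
  rewrite !exprS; ring.
rewrite raddfB/= [X in X - _]linearZ [X in _ - X]linearZ/= IH mulr0 sub0r => /eqP.
by rewrite oppr_eq0 mulf_eq0 gt_eqF ?ltr_wpDl//= => /eqP.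
Qed.

Section JacobiPolynomials.
Context {R : realType}.
Variables (gamma delta d c : R).
Hypotheses (ltgd : gamma < delta) (d1 : -1 < d) (c1 : -1 < c).
Hypothesis iw : weight_integrable gamma delta (wP gamma delta d c).

Local Notation P := (Pn gamma delta d c).
Local Notation Pt := (Pn gamma delta (d + 1) (c + 1)).
Local Notation r := (rJ gamma delta (d + 1) (c + 1)).
Local Notation t := (tJ gamma delta (d + 1) (c + 1)).
Local Notation s := (sJ gamma delta (d + 1) (c + 1)).
Local Notation del := (deltaJ gamma delta (d + 1) (c + 1)).
Local Notation gam := (gammaJ gamma delta (d + 1) (c + 1)).
Local Notation dd := (dJ gamma delta (d + 1) (c + 1)).

Lemma raisePE : raiseP gamma delta (d + 1) (c + 1) = conn_mx Pt P.
Proof. by rewrite /raiseP !addrK. Qed.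

Lemma dJE n : dd n = conn_mx Pt (fun i => (P i)^`()) n n.+1.
Proof. by rewrite /dJ !addrK. Qed.

Lemma Pt_graded : graded Pt.
Proof. by have [L [Lt [_ []]]] := wP_functionals ltgd d1 c1 iw. Qed.

Lemma jacobi_raise k : P k = r k *: Pt k
  - (if (0 < k)%N then t k.-1 *: Pt k.-1 else 0)
  - (if (1 < k)%N then s k.-2 *: Pt k.-2 else 0).
Proof.
have [L [Lt [oP oPt LtE _ _]]] := wP_functionals ltgd d1 c1 iw.
have := raise_expand oP oPt LtE (size_endpoints gamma delta)
  (log_lin_lead gamma delta d c) k.
rewrite /rJ /tJ /sJ !raisePE; case: k => [|[|k]] /=.
- by move=> ->; rewrite !subr0 !addr0.
- by move=> ->; rewrite scaleNr opprK subr0 addr0.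
- by move=> ->; rewrite !scaleNr !opprK.
Qed.

Lemma jacobi_mulX_deriv k : 'X * (P k)^`() = (k%:R * r k) *: Pt k
  + (if (0 < k)%N then (gam k.-1 * dd k.-1) *: Pt k.-1 else 0)
  + (if (1 < k)%N then (del k.-2 * dd k.-1) *: Pt k.-2 else 0).
Proof.
have [L [Lt [oP oPt LtE pL _]]] := wP_functionals ltgd d1 c1 iw.
have := mulX_deriv_expand oP oPt LtE (size_endpoints gamma delta)
  (log_lin_lead gamma delta d c) pL k.
rewrite /rJ /gammaJ /deltaJ !raisePE !dJE.
by case: k => [|[|k]] /=.
Qed.

(** With n = k + 2, adding n s_k to both sides gives (c + d + 2n + 1) s_k, the
    value at which the terms in rho'/rho cancel. *)
Lemma jacobi_delta k : del k * dd k.+1 = (k.+1%:R + (d + c + 2)) * s k.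
Proof.
have [L [Lt [oP oPt LtE pL _]]] := wP_functionals ltgd d1 c1 iw.
have := mulX_deriv_low oP oPt LtE (size_endpoints gamma delta)
  (log_lin_lead gamma delta d c) pL k.
by rewrite /deltaJ /sJ raisePE dJE mulrN -mulNr => <-; rewrite mulrC.
Qed.

(** The symmetric weight makes P n and Pt n even or odd with n. *)
Lemma jacobi_symmetric n : delta = - gamma -> c = d -> t n = 0 /\ gam n = 0.
Proof.
move=> gE cE.
have [L [Lt [oP oPt LtE pL pLt]]] := wP_functionals ltgd d1 c1 iw.
have gE' : gamma = - delta by rewrite gE opprK.
have cE' : d = c by rewrite cE.
have evL : forall p, L (p \Po - 'X) = L p.
  apply/functional_even/(@symmetric_odd_moments _ delta c) => //.
  by move: pL; rewrite gE' cE'.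
have evLt : forall p, Lt (p \Po - 'X) = Lt p.
  apply/functional_even/(@symmetric_odd_moments _ delta (c + 1)).
    by rewrite (lt_trans c1)// ltrDl.
  by move: pLt; rewrite gE' cE'.
split; first by rewrite /tJ raisePE (raise_even oP oPt evLt evL) oppr0.
by rewrite /gammaJ; exact: mult_even oPt evLt n.
Qed.

End JacobiPolynomials.

(** * The x-derivative of a Koornwinder polynomial *)

Lemma mem_zrange (lo hi m : int) : (m \in zrange lo hi) = (lo <= m <= hi).
Proof.
apply/mapP/idP => [[i]|/andP[lom mhi]].
  by rewrite mem_iota => iN ->; lia.
by exists (absz (m - lo)); [rewrite mem_iota; lia|lia].
Qed.

Lemma zrange_uniq lo hi : uniq (zrange lo hi).
Proof. by rewrite map_inj_uniq ?iota_uniq// => i j /addrI []. Qed.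

Lemma zrange_sum (V : nmodType) (f : int -> V) (lo hi : int) (N : nat) :
  (forall m, m < 0 -> f m = 0) ->
  (forall m : nat, (m%:Z < lo) || (hi < m%:Z) -> f m = 0) -> hi < N%:Z ->
  \sum_(m <- zrange lo hi) f m = \sum_(m < N) f m.
Proof.
move=> fneg fout hiN.
have supp (s : seq int) : \sum_(m <- s) f m = \sum_(m <- s | f m != 0) f m.
  by rewrite [RHS]big_mkcond; apply: eq_bigr => m _; case: eqP.
rewrite -(big_mkord xpredT (fun i => f (Posz i))) -(big_map Posz xpredT).
rewrite supp [RHS]supp -big_filter -[RHS]big_filter; apply: perm_big.
apply: uniq_perm; [exact/filter_uniq/zrange_uniq| |move=> m].
  by rewrite filter_uniq// map_inj_uniq ?iota_uniq// => i j [].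
rewrite !mem_filter mem_zrange; case: (eqVneq (f m) 0) => //= fm.
case: m fm => [m|m] fm; last by rewrite fneg ?eqxx in fm.
rewrite (mem_map (fun i j => _)) ?mem_iota; last by move=> i j [].
apply/idP/idP; first by lia.
by move=> mN; apply: contraNT fm => out; rewrite fout//; lia.
Qed.

Lemma eq_if_else (T : Type) (e : bool) (u v w : T) :
  (e = false -> v = w) -> (if e then u else v) = (if e then u else w).
Proof. by case: e => // ->. Qed.

Lemma sum_if_else (V : nmodType) (e : bool) N (f : nat -> V) :
  \sum_(m < N) (if e then 0 else f m) = if e then 0 else \sum_(m < N) f m.
Proof. by case: e => //; rewrite big1. Qed.

Section Main.
Context {R : realType}.
Variables (alpha beta gamma delta : R) (eta : bool) (q : {poly R}) (a b c d : R).
Hypotheses (ltab : alpha < beta) (ltgd : gamma < delta)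
    (rho_gt0 : forall x, alpha < x < beta -> 0 < rho eta q x)
    (sym_gd : eta -> delta = - gamma /\ 0 < delta)
    (deg_q : (2 + eta <= (size q).-1)%N)
    (a_gt : -1 < a) (b_gt : -1 < b) (c_gt : -1 < c) (d_gt : -1 < d)
    (eq_cd : eta -> c = d)
    (int_wR : weight_integrable alpha beta (wR alpha beta eta q a b (c + d + 1)))
    (int_wP : weight_integrable gamma delta (wP gamma delta d c)).

Local Notation rho := (rho eta q).
Local Notation rho2 := (rho2 eta q).
Local Notation rho_drho := (rho_drho eta q).
Local Notation integrable s := (weight_integrable alpha beta (wR alpha beta eta q a b s)).
Local Notation H := (koornwinder alpha beta eta q gamma delta a b c d).
Local Notation K := (koornwinder alpha beta eta q gamma delta (a + 1) (b + 1) (c + 1) (d + 1)).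
Local Notation H1 := (koornwinderz alpha beta eta q gamma delta (a + 1) (b + 1) (c + 1) (d + 1)).
Local Notation cx0 := (cx0 alpha beta eta q gamma delta a b c d).
Local Notation cx2 := (cx2 alpha beta eta q gamma delta a b c d).
Local Notation cx1 := (cx1 alpha beta q gamma delta a b c d).
Local Notation Rn := (Rn alpha beta eta q).
Local Notation P := (Pn gamma delta d c).
Local Notation Pt := (Pn gamma delta (d + 1) (c + 1)).
Local Notation deg2 := (size rho2).-1.
Local Notation d0 := (size q).-1.
Local Notation r := (rJ gamma delta (d + 1) (c + 1)).
Local Notation t := (tJ gamma delta (d + 1) (c + 1)).
Local Notation s := (sJ gamma delta (d + 1) (c + 1)).
Local Notation del := (deltaJ gamma delta (d + 1) (c + 1)).
Local Notation gam := (gammaJ gamma delta (d + 1) (c + 1)).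
Local Notation dd := (dJ gamma delta (d + 1) (c + 1)).

(** The exponent of rho in the weight of the x-factor of H_{m,j} with raised
    parameters. *)
Definition target_index (j : nat) : R := c + 1 + (d + 1) + (2 * j)%:R + 1.

Lemma base_gtN1 p : -1 < c + d + 1 + p%:R.
Proof.
have s0 : -1 < c + d + 1 by move: c_gt d_gt => c1 d1; lra.
by rewrite (lt_le_trans s0)// lerDl ler0n.
Qed.

Lemma integrable_base p : integrable (c + d + 1 + p%:R).
Proof.
elim: p => [|p IH]; first by rewrite addr0.
by rewrite -natr1 addrA; apply: integrable_rho => //; exact: base_gtN1.
Qed.

Lemma size_q : (2 < size q)%N.
Proof. by move: deg_q; clear; lia. Qed.

Lemma imx_entryZ (e : R) (M : imx R) i j :
  imx_entry (fun i j => e * M i j) i j = e * imx_entry M i j.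
Proof. by case: i j => [i|i] [j|j] /=; rewrite ?mulr0. Qed.

(** H_{m,j} contains the (m - j)-th element of the basis, so summing over m the
    entries of a column against H_{m,j} evaluates the polynomial represented by
    that column. *)
Lemma entry_sum (M : imx R) (j nu N : nat) x y :
  (forall i, (N <= i + j)%N -> M i nu = 0) -> (j <= N)%N ->
  \sum_(m < N) imx_entry M (m%:Z - j%:Z) nu%:Z * H1 m%:Z j%:Z x y =
  (row_mul (Rn (a + 1) (b + 1) (target_index j)) M nu).[x] * rho x ^+ j *
    (Pt j).[y / rho x].
Proof.
move=> M0 jN; rewrite (@row_mulE _ _ _ _ (N - j)); last first.
  by move=> i iN; apply: M0; clear -iN; lia.
rewrite -(big_mkord xpredT (fun m => imx_entry M (m%:Z - j%:Z) nu%:Z * H1 m%:Z j%:Z x y)).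
rewrite (@big_cat_nat _ _ _ j)//= big_nat_cond big1 ?add0r; last first.
  by move=> m /andP[/andP[_ mj] _]; rewrite leqNgt mj mulr0.
rewrite -{1}[j]add0n big_addn big_mkord horner_sum !mulr_suml.
apply: eq_bigr => i _; rewrite leq_addl hornerZ /koornwinder addnK.
have -> : (i + j)%:Z - j%:Z = i%:Z by clear; lia.
by rewrite /= !mulrA.
Qed.

Lemma derive_koornwinder n k x y : 0 < rho x ->
  let Rx := Rn a b (c + d + (2 * k)%:R + 1) (n - k) in
  is_derive x (1 : R) (fun x' => koornwinder alpha beta eta q gamma delta a b c d n k x' y)
    (Rx^`().[x] * rho x ^+ k * (P k).[y / rho x] +
     Rx.[x] * rho x ^+ k * (rho_drho.[x] / rho x ^+ 2) *
       (k%:R * (P k).[y / rho x] - ('X * (P k)^`()).[y / rho x])).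
Proof.
move=> r0 /=; rewrite /koornwinder; set Rx := Rn _ _ _ _.
have rn0 : rho x != 0 by rewrite gt_eqF.
have Dr := is_derive_rho r0.
have Dk := @is_deriveX _ _ rho k x 1 _ Dr; rewrite exprfctE in Dk.
have DV := @is_deriveV _ rho x _ 1 rn0 Dr.
have Dz : is_derive x (1 : R) (fun x' => y / rho x')
    (y * (- rho x ^- 2 * (rho_drho.[x] / rho x))).
  apply: (is_derive_eq (is_deriveM (is_derive_cst y x 1) DV)).
  by rewrite scaler0 addr0.
have DP := @is_derive1_comp _ (horner (P k)) (fun x' => y / rho x') x _ _
  (is_derive_poly (P k) _) Dz.
have D := is_deriveM (is_deriveM (is_derive_poly Rx x) Dk) DP.
apply: (is_derive_eq D); rewrite !fctE /= /GRing.scale/= hornerM hornerX.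
case: k @Rx Dk DP D => [|k] Rx Dk DP D.
  by rewrite !expr0; field.
by rewrite /= !exprS; field.
Qed.

Lemma cx0_spec n k : (k <= n)%N ->
  (forall m : nat, (k <= m)%N -> (m + deg2 + 1 < n)%N || (n <= m)%N ->
     cx0 n k m%:Z = 0) /\
  (forall N x y, (n <= N)%N ->
     \sum_(m < N) cx0 n k m%:Z * H1 m%:Z k%:Z x y =
     r k * (Rn a b (c + d + (2 * k)%:R + 1) (n - k))^`().[x] * rho x ^+ k *
     (Pt k).[y / rho x]).
Proof.
move=> kn; set s0 := c + d + (2 * k)%:R + 1.
have s0E : s0 = c + d + 1 + (2 * k)%:R by rewrite /s0 addrAC.
have s0N : -1 < s0 by rewrite s0E; exact: base_gtN1.
have is0 : integrable s0 by rewrite s0E; exact: integrable_base.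
have s1E : c + d + (2 * k)%:R + 2 + eta%:R = s0 + 1 + eta%:R by rewrite /s0; ring.
have s2E : c + d + (2 * k)%:R + 3 = s0 + 2 by rewrite /s0; ring.
have := deriv_matrix ltab a_gt b_gt rho_gt0 size_q s0N is0 s1E s2E.
set M := imx_mul _ _ => -[gQ fM ME M0].
have cxE m : cx0 n k m = r k * imx_entry M (m - k%:Z) (n - k)%N%:Z.
  by rewrite /Defs.cx0 imx_entryZ -subzn.
split=> [m km out|N x y nN].
  rewrite cxE subzn// /= M0 ?mulr0//; clear -kn km out; lia.
transitivity (r k * \sum_(m < N) imx_entry M (m%:Z - k%:Z) (n - k)%N%:Z * H1 m%:Z k%:Z x y).
  by rewrite mulr_sumr; apply: eq_bigr => m _; rewrite cxE mulrA.
rewrite entry_sum; [|move=> i iN; apply: M0; clear -kn nN iN; lia|clear -kn nN; lia].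
have -> : target_index k = c + d + (2 * k)%:R + 3 by rewrite /target_index; ring.
by rewrite ME !mulrA.
Qed.

Lemma cx2_spec n k : (k.+2 <= n)%N ->
  (forall m : nat, (k <= m)%N -> (m + 3 < n)%N || (n + deg2 < m + 3)%N ->
     cx2 n k.+2 m%:Z = 0) /\
  (forall N x y, (n + deg2 < N + 3)%N -> (k <= N)%N ->
     \sum_(m < N) cx2 n k.+2 m%:Z * H1 m%:Z k%:Z x y =
     (- s k * rho2.[x] * (Rn a b (c + d + (2 * k.+2)%:R + 1) (n - k.+2))^`().[x]
      - (k.+2%:R * s k + del k * dd k.+1) * rho_drho.[x] *
        (Rn a b (c + d + (2 * k.+2)%:R + 1) (n - k.+2)).[x]) * rho x ^+ k *
     (Pt k).[y / rho x]).
Proof.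
move=> kn; set t0 := c + d + (2 * k.+2)%:R + 1.
pose s3 := c + d + (2 * k.+2)%:R - 2 - eta%:R.
have s3E : s3 = c + d + 1 + (2 * k + 1 - eta)%N%:R.
  by rewrite /s3; case: (eta); rewrite /= ?subn0 ?addnK !mulnS !natrD ?mulr0n; ring.
have s3N : -1 < s3 by rewrite s3E; exact: base_gtN1.
have is3 : integrable s3 by rewrite s3E; exact: integrable_base.
have sigE : c + d + (2 * k.+2)%:R - 1 = s3 + 1 + eta%:R by rewrite /s3; ring.
have t0E : t0 = c + d + (2 * k.+2)%:R - 1 + 2 by rewrite /t0; ring.
have kE : k.+2%:R * s k + del k * dd k.+1 = s k * t0.
  rewrite (jacobi_delta ltgd d_gt c_gt int_wP) /t0.
  by rewrite mulnC muln2 -addnn natrD -natr1; ring.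
have := lower2_matrix ltab a_gt b_gt rho_gt0 size_q s3N is3 sigE t0E kE.
rewrite /=; set M := lower2_mx _ _ _ _ _ _ _ _ _ _ _ => -[gQ fM ME M0].
have cxE (m : int) : cx2 n k.+2 m = imx_entry M (m - k%:Z) (n - k.+2)%N%:Z.
  rewrite -subzn//; have -> : m - k%:Z = m - k.+2%:Z + 2 by clear; lia.
  by rewrite /Defs.cx2 !subSS !subn0.
split=> [m km out|N x y nN kN].
  rewrite cxE subzn// /= M0//; clear -kn km out; lia.
under eq_bigr do rewrite cxE.
rewrite entry_sum//; last by move=> i iN; apply: M0; clear -kn nN iN; lia.
have -> : target_index k = c + d + (2 * k.+2)%:R - 1.
  by rewrite /target_index !mulnS !natrD; ring.
rewrite ME hornerD hornerN !(hornerZ _ (_ * _)) (hornerM rho2) (hornerM rho_drho).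
by rewrite !mulrA.
Qed.

Lemma cx1_spec n k : eta = false -> (k.+1 <= n)%N ->
  (forall m : nat, (k <= m)%N -> (m + d0 + 2 < n)%N || (n + d0 < m + 2)%N ->
     cx1 n k.+1 m%:Z = 0) /\
  (forall N x y, (n + d0 < N + 2)%N -> (k <= N)%N ->
     \sum_(m < N) cx1 n k.+1 m%:Z * H1 m%:Z k%:Z x y =
     (- t k * q.[x] * (Rn a b (c + d + (2 * k.+1)%:R + 1) (n - k.+1))^`().[x]
      - (k.+1%:R * t k + gam k * dd k) * q^`().[x] *
        (Rn a b (c + d + (2 * k.+1)%:R + 1) (n - k.+1)).[x]) * rho x ^+ k *
     (Pt k).[y / rho x]).
Proof.
move=> eta0 kn; set tau1 := c + d + (2 * k.+1)%:R + 1.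
pose tau := c + d + (2 * k.+1)%:R.
have tE : tau = c + d + 1 + (2 * k + 1)%N%:R.
  by rewrite /tau !mulnS !natrD; ring.
have tN : -1 < tau by rewrite tE; exact: base_gtN1.
have it : integrable tau by rewrite tE; exact: integrable_base.
have rho0 := rho_gt0; rewrite eta0 in rho0 it.
have := @lower1_matrix _ _ _ _ _ _ ltab a_gt b_gt rho0 size_q (t k)
   (k.+1%:R * t k + gam k * dd k) tau tau1 tN it erefl.
rewrite /=; set M := lower1_mx _ _ _ _ _ _ _ _ _ => -[gQ fM ME M0].
have cxE (m : int) : cx1 n k.+1 m = imx_entry M (m - k%:Z) (n - k.+1)%N%:Z.
  rewrite -subzn//; have -> : m - k%:Z = m - k.+1%:Z + 1 by clear; lia.
  by rewrite /Defs.cx1 !subSS !subn0.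
split=> [m km out|N x y nN kN].
  rewrite cxE subzn// /= M0//; clear -kn km out; lia.
under eq_bigr do rewrite cxE.
rewrite entry_sum//; last by move=> i iN; apply: M0; clear -kn nN iN; lia.
have -> : target_index k = tau1.
  by rewrite /target_index /tau1 !mulnS !natrD; ring.
rewrite eta0 ME hornerD hornerN !(hornerZ _ (_ * _)) (hornerM q) (hornerM q^`()).
by rewrite !mulrA.
Qed.

Lemma d0_le_deg2 : (d0 <= deg2)%N.
Proof.
rewrite /Defs.rho2; case: (eta) => //.
have q0 : q != 0 by rewrite -size_poly_gt0 (leq_trans _ size_q).
rewrite expr2 size_mul//; case: (size q) => [|n]//=.
by rewrite addnS leq_addr.
Qed.

Lemma koornwinderz_neg m (j : int) x y : j < 0 -> H1 m j x y = 0.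
Proof. by case: j => // j _; case: m. Qed.

(** The expansion of the derivative, with the three ranges of summation replaced by
    a common one; the additional terms vanish. *)
Definition cx_sum n k N x y : R :=
  \sum_(m < N) cx0 n k m%:Z * H1 m%:Z k%:Z x y
  + \sum_(m < N) cx2 n k m%:Z * H1 m%:Z (k%:Z - 2) x y
  + (if eta then 0 else \sum_(m < N) cx1 n k m%:Z * H1 m%:Z (k%:Z - 1) x y).

Lemma derive_koornwinder_sum n k N x y : (k <= n)%N -> (n + deg2 < N)%N ->
  0 < rho x -> is_derive x (1 : R) (fun x' => H n k x' y) (cx_sum n k N x y).
Proof.
move=> kn nN r0; apply: (is_derive_eq (derive_koornwinder n k y r0)).
have rn0 : rho x != 0 by rewrite gt_eqF.
have nN0 : (n <= N)%N by clear -nN; lia.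
have nN3 : (n + deg2 < N + 3)%N by clear -nN; lia.
have nN1 : (n + d0 < N + 2)%N.
  apply: (@leq_ltn_trans (n + deg2)); first by rewrite leq_add2l d0_le_deg2.
  by clear -nN; lia.
have rho2E : rho2.[x] = rho x ^+ 2 by apply: rho_sqr; exact: ltW (q_gt0 r0).
have PE := jacobi_raise ltgd d_gt c_gt int_wP k.
have XE := jacobi_mulX_deriv ltgd d_gt c_gt int_wP k.
have sum_neg (f : nat -> R) (j : int) : j < 0 ->
    \sum_(m < N) f m * H1 m%:Z j x y = 0.
  by move=> j0; rewrite big1// => m _; rewrite koornwinderz_neg// mulr0.
rewrite /cx_sum ((cx0_spec kn).2 _ _ _ nN0).
have cx1E j : k = j.+1 ->
    (if eta then 0 else \sum_(m < N) cx1 n k m%:Z * H1 m%:Z (k%:Z - 1) x y) =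
    - (t j * rho x * (Rn a b (c + d + (2 * k)%:R + 1) (n - k))^`().[x]
      + (k%:R * t j + gam j * dd j) * (rho_drho.[x] / rho x) *
        (Rn a b (c + d + (2 * k)%:R + 1) (n - k)).[x]) * rho x ^+ j * (Pt j).[y / rho x].
  move=> kE; have [etaE|etaE] : eta = true \/ eta = false by case: (eta); [left|right].
    rewrite {1}etaE.
    have [[dE _] cE] := (sym_gd etaE, eq_cd etaE).
    have [-> ->] := jacobi_symmetric ltgd d_gt c_gt int_wP j dE cE.
    by rewrite !(mulr0, mul0r, addr0, oppr0).
  have jN : (j <= N)%N by clear -kE kn nN0; lia.
  have rhoE : rho x = q.[x] by rewrite /Defs.rho etaE.
  have drE : rho_drho.[x] / rho x = q^`().[x].
    have qn0 : q.[x] != 0 by rewrite -rhoE.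
    by rewrite /Defs.rho_drho hornerZ rhoE /Defs.rho2 etaE expr2 derivM hornerD !hornerM; field.
  rewrite {1}etaE; have -> : k%:Z - 1 = j%:Z by rewrite kE; clear; lia.
  rewrite drE rhoE -rhoE; rewrite {1 2 3}kE ((cx1_spec etaE _).2 _ _ _ nN1 jN) -?kE//.
  by rewrite rhoE; ring.
case: k kn PE XE cx1E => [|[|k]] kn PE XE cx1E.
- have S2 : \sum_(m < N) cx2 n 0 m%:Z * H1 m%:Z (0%:Z - 2) x y = 0.
    exact: (sum_neg (fun m => cx2 n 0 m%:Z)).
  have S1 : (if eta then 0
      else \sum_(m < N) cx1 n 0 m%:Z * H1 m%:Z (0%:Z - 1) x y) = 0.
    by case: ifP => // _; exact: (sum_neg (fun m => cx1 n 0 m%:Z)).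
  rewrite S2 S1 XE {1 2}PE; move: (Rn _ _ _ _) => F.
  rewrite !subr0 !addr0 !(hornerZ _ (Pt _)).
  by ring.
- have S2 : \sum_(m < N) cx2 n 1 m%:Z * H1 m%:Z (1%:Z - 2) x y = 0.
    exact: (sum_neg (fun m => cx2 n 1 m%:Z)).
  rewrite S2 (cx1E 0%N erefl) XE {1 2}PE; move: (Rn _ _ _ _) => F.
  rewrite !subr0 !addr0 !(hornerD, hornerN, hornerZ _ (Pt _)) succnK.
  by field.
rewrite (cx1E k.+1 erefl) XE {1 2}PE.
have -> : k.+2%:Z - 2 = k%:Z by clear; lia.
rewrite ((cx2_spec kn).2 _ _ _ nN3); last by clear -kn nN0; lia.
move: (Rn _ _ _ _) => F.
rewrite !(hornerD, hornerN, hornerZ _ (Pt _)) rho2E !succnK.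
rewrite !exprS; field.
exact: rn0.
Qed.

Lemma koornwinderz_above (m j : nat) x y : (m < j)%N -> H1 m%:Z j%:Z x y = 0.
Proof. by move=> mj; rewrite /= leqNgt mj. Qed.

Lemma koornwinderz_negm (m j : int) x y : m < 0 -> H1 m j x y = 0.
Proof. by case: m. Qed.

Lemma cx_sum_zrange n k N x y : (k <= n)%N -> (n + deg2 < N)%N ->
  \sum_(m <- zrange (n%:Z - deg2%:Z - 1) (n%:Z - 1)) cx0 n k m * H1 m k%:Z x y
  + \sum_(m <- zrange (n%:Z - 3) (n%:Z + deg2%:Z - 3)) cx2 n k m * H1 m (k%:Z - 2) x y
  + (if eta then 0 else
     \sum_(m <- zrange (n%:Z - d0%:Z - 2) (n%:Z + d0%:Z - 2))
       cx1 n k m * H1 m (k%:Z - 1) x y) = cx_sum n k N x y.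
Proof.
move=> kn nN; have dd := d0_le_deg2; rewrite /cx_sum; congr (_ + _ + _).
- apply: zrange_sum => [m m0|m out|].
  + by rewrite koornwinderz_negm ?mulr0.
  + have [km|mk] := leqP k m; last by rewrite koornwinderz_above ?mulr0.
    rewrite (cx0_spec _).1 ?mul0r//; clear -out; lia.
  + clear -nN; lia.
- apply: zrange_sum => [m m0|m out|].
  + by rewrite koornwinderz_negm ?mulr0.
  + case: k kn => [|[|k]] kn; [by rewrite koornwinderz_neg ?mulr0..|].
    have -> : k.+2%:Z - 2 = k%:Z by clear; lia.
    have [km|mk] := leqP k m; last by rewrite koornwinderz_above ?mulr0.
    rewrite (cx2_spec _).1 ?mul0r//; clear -out; lia.
  + clear -nN; lia.
apply: eq_if_else => etaE; apply: zrange_sum => [m m0|m out|].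
- by rewrite koornwinderz_negm ?mulr0.
- case: k kn => [|k] kn; first by rewrite koornwinderz_neg ?mulr0.
  have -> : k.+1%:Z - 1 = k%:Z by clear; lia.
  have [km|mk] := leqP k m; last by rewrite koornwinderz_above ?mulr0.
  rewrite (cx1_spec etaE _).1 ?mul0r//; clear -out; lia.
by clear -nN dd; lia.
Qed.

(** * The block matrix of the x-derivative *)
Definition Dx_matrix : bmx R := fun m n => \matrix_(j, k)
  ((j == k :> nat)%:R * cx0 n k m%:Z + (j + 2 == k)%N%:R * cx2 n k m%:Z
   + (if eta then 0 else (j + 1 == k)%N%:R * cx1 n k m%:Z)).

Lemma shifted_column (m k t : nat) (e x y : R) :
  \sum_(j < m.+1) K m j x y * ((j + t == k)%N%:R * e) = e * H1 m%:Z (k%:Z - t%:Z) x y.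
Proof.
have [tk|kt] := leqP t k; last first.
  rewrite koornwinderz_neg ?mulr0; last by clear -kt; lia.
  rewrite big1// => j _; rewrite (_ : (j + t == k)%N = false) ?mul0r ?mulr0//.
  by apply/eqP; clear -kt; lia.
rewrite subzn//; have [km|mk] := leqP (k - t)%N m; last first.
  rewrite koornwinderz_above// mulr0 big1// => j _.
  rewrite (_ : (j + t == k)%N = false) ?mul0r ?mulr0//.
  by apply/eqP; have := ltn_ord j; clear -mk tk; lia.
have km' : (k - t < m.+1)%N by [].
rewrite (bigD1 (Ordinal km'))//= subnK// eqxx mul1r big1 ?addr0; last first.
  move=> j /negP jk; rewrite (_ : (j + t == k)%N = false) ?mul0r ?mulr0//.
  apply/eqP => jtk; apply: jk; apply/eqP/val_inj => /=; clear -jtk; lia.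
by rewrite km mulrC.
Qed.

(** The diagonals j = k, k - 1 and k - 2 of a block carry the three families of
    coefficients, each confined to its own range of m. *)
Lemma Dx_matrix_banded (m n : nat) (j : 'I_m.+1) (k : 'I_n.+1) :
  ((deg2%:Z - 3 < m%:Z - n%:Z) || (deg2%:Z + 1 < n%:Z - m%:Z)) ||
  ((0 < j%:Z - k%:Z) || (2 < k%:Z - j%:Z)) -> Dx_matrix m n j k = 0.
Proof.
have kn : (k <= n)%N by rewrite -ltnS.
have jm : (j <= m)%N by rewrite -ltnS.
have dd := d0_le_deg2.
have d2 := deg2_gt0 eta size_q.
move=> out; rewrite mxE.
have -> : (j == k :> nat)%:R * cx0 n k m%:Z = 0.
  case: eqP => [jk|_]; last by rewrite mul0r.
  rewrite (cx0_spec _).1 ?mulr0// -?jk//; clear -out jk d2; lia.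
have -> : (j + 2 == k)%N%:R * cx2 n k m%:Z = 0.
  case: eqP => [jk|_]; last by rewrite mul0r.
  have kE : nat_of_ord k = j.+2 by rewrite -jk addn2.
  rewrite kE (cx2_spec _).1 ?mulr0// -?kE//; clear -out kE d2; lia.
rewrite !add0r.
case: ifP => etaE; first by [].
case: eqP => [jk|_]; last by rewrite mul0r.
have kE : nat_of_ord k = j.+1 by rewrite -jk addn1.
have dE : deg2 = (d0 + d0)%N.
  rewrite /Defs.rho2 etaE expr2 size_mul; last 2 first.
  - by rewrite -size_poly_gt0 (leq_trans _ size_q).
  - by rewrite -size_poly_gt0 (leq_trans _ size_q).
  by have := size_q; case: (size q) => [|p]//= _; rewrite addnS.
rewrite kE (cx1_spec etaE _).1 ?mulr0// -?kE//; clear -out kE d2 dE; lia.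
Qed.

Lemma Dx_matrixP : is_Dx alpha beta eta q gamma delta a b c d Dx_matrix.
Proof.
have bnd n m : (n + deg2 < m)%N -> Dx_matrix m n = 0.
  move=> nm; apply/matrixP => j k; rewrite [RHS]mxE Dx_matrix_banded//.
  by clear -nm; lia.
split=> [n|n k x y _ r0].
  by exists (n + deg2).+1 => m; exact: bnd.
have kn : (k <= n)%N by rewrite -ltnS.
apply: (is_derive_eq (derive_koornwinder_sum y kn (ltnSn _) r0)).
rewrite (@fsum_nat _ _ (n + deg2).+1); last first.
  by move=> m nm; rewrite bnd// big1// => j _; rewrite mxE mulr0.
rewrite /cx_sum.
have colE (m : nat) : \sum_(j < m.+1) K m j x y * Dx_matrix m n j k =
    cx0 n k m%:Z * H1 m%:Z k%:Z x y + cx2 n k m%:Z * H1 m%:Z (k%:Z - 2) x y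
    + (if eta then 0 else cx1 n k m%:Z * H1 m%:Z (k%:Z - 1) x y).
  rewrite -(shifted_column m k 2) -(shifted_column m k 1).
  have -> : k%:Z = k%:Z - 0%:Z by rewrite subr0.
  rewrite -(shifted_column m k 0); case: ifP => etaE.
    rewrite addr0 -big_split/=; apply: eq_bigr => j _.
    by rewrite mxE etaE addr0 addn0 mulrDr.
  rewrite -!big_split/=; apply: eq_bigr => j _.
  by rewrite mxE etaE addn0 !mulrDr.
rewrite -(sum_if_else eta _ (fun m => cx1 n k m%:Z * H1 m%:Z (k%:Z - 1) x y)).
by rewrite -!big_split; apply: eq_bigr => m _; rewrite colE.
Qed.

(** The difference of two solutions is a vanishing combination of the H_{m,j} at
    every point of the domain.  In the coordinates (x, z) with y = rho x * z,
    independence of the Pt_j in z and then of the R_i in x kills its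
    coefficients. *)
Lemma is_Dx_unique D D' : is_Dx alpha beta eta q gamma delta a b c d D ->
  is_Dx alpha beta eta q gamma delta a b c d D' -> D = D'.
Proof.
move=> [fD DE] [fD' D'E].
apply: functional_extensionality_dep => m0; apply: functional_extensionality_dep => n.
apply/matrixP => j0 k.
have [N1 DN] := fD n; have [N2 DN'] := fD' n.
pose N := maxn m0.+1 (maxn N1 N2).
have bD m : (N <= m)%N -> D m n = 0.
  by move=> Nm; apply: DN; move: Nm; rewrite !geq_max => /and3P[].
have bD' m : (N <= m)%N -> D' m n = 0.
  by move=> Nm; apply: DN'; move: Nm; rewrite !geq_max => /and3P[].
(* The coefficient of H_{m,j}, extended by zero above the diagonal. *)
pose E m j : R := if (j <= m)%N then (D m n (inord j) k - D' m n (inord j) k) else 0.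
have gPt := Pt_graded ltgd d_gt c_gt int_wP.
have gR j : graded (Rn (a + 1) (b + 1) (target_index j)).
  apply: (Rn_graded ltab rho_gt0).
  have -> : target_index j = c + d + 1 + (2 * j.+1)%N%:R.
    by rewrite /target_index mulnS natrD; ring.
  exact: integrable_endpoints (integrable_base _).
have sum0 x z : alpha < x < beta -> gamma < z < delta ->
    \sum_(j < N) (rho x ^+ j * \sum_(m < N) E m j *
      (Rn (a + 1) (b + 1) (target_index j) (m - j)).[x]) * (Pt j).[z] = 0.
  move=> xab zgd; have r0 := rho_gt0 xab.
  have rn0 : rho x != 0 by rewrite gt_eqF.
  have Om : Omega alpha beta eta q gamma delta (x, rho x * z).
    rewrite /Omega /=; have /andP[/ltW -> /ltW ->] := xab; split=> //.
    have /andP[/ltW gz /ltW zd] := zgd.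
    by rewrite [rho x * z]mulrC !ler_pM2r// gz zd.
  have [_ d1] := DE n k x _ Om r0; have [_ d2] := D'E n k x _ Om r0.
  move: d1; rewrite d2 => {d2}.
  rewrite (@fsum_nat _ _ N); last first.
    by move=> m Nm; rewrite big1// => j _; rewrite bD' ?mxE ?mulr0.
  rewrite (@fsum_nat _ _ N); last first.
    by move=> m Nm; rewrite big1// => j _; rewrite bD ?mxE ?mulr0.
  move/esym/eqP; rewrite -subr_eq0 -sumrB => /eqP sum0.
  rewrite -[RHS]sum0.
  under eq_bigr do rewrite mulr_sumr mulr_suml.
  rewrite exchange_big/=; apply: eq_bigr => m _.
  rewrite -sumrB.
  pose f j := K m j x (rho x * z) * (D m n (inord j) k - D' m n (inord j) k).
  transitivity (\sum_(j < m.+1) f j); last first.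
    by apply: eq_bigr => j _; rewrite /f inord_val mulrBr.
  rewrite (big_ord_widen N f (ltn_ord m)) [RHS]big_mkcond/=; apply: eq_bigr => j _.
  rewrite ltnS /E; case: leqP => jm; last by rewrite mul0r mulr0 mul0r.
  by rewrite /f /koornwinder -/(target_index j) [rho x * z]mulrC mulfK//; ring.
have coef0 x j : (j < N)%N -> alpha < x < beta -> \sum_(m < N) E m j *
    (Rn (a + 1) (b + 1) (target_index j) (m - j)).[x] = 0.
  move=> jN xab; pose C j := rho x ^+ j * \sum_(m < N) E m j *
    (Rn (a + 1) (b + 1) (target_index j) (m - j)).[x].
  have /(graded_free gPt)/(_ j jN)/eqP : \sum_(j < N) C j *: Pt j = 0.
    apply: (poly_itv_eq0 ltgd) => z zgd; rewrite horner_sum -[RHS](sum0 x z xab zgd).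
    by apply: eq_bigr => i _; rewrite hornerZ.
  by rewrite mulf_eq0 expf_eq0 gt_eqF ?rho_gt0// andbF => /eqP.
have jm : (j0 <= m0)%N by rewrite -ltnS.
have mN : (m0 < N)%N by rewrite /N leq_max ltnSn.
have jN : (j0 < N)%N by exact: leq_ltn_trans jm mN.
have /(@graded_free _ _ (fun i => E (i + j0)%N j0) _ (gR j0))/(_ (m0 - j0)%N) : \sum_(i < N - j0)
    E (i + j0)%N j0 *: Rn (a + 1) (b + 1) (target_index j0) i = 0.
  apply: (poly_itv_eq0 ltab) => x xab; rewrite horner_sum -[RHS](coef0 x j0 jN xab).
  rewrite -[RHS](big_mkord xpredT (fun m => E m j0 *
    (Rn (a + 1) (b + 1) (target_index j0) (m - j0)).[x])).
  rewrite (@big_cat_nat _ _ _ j0)//= ?(ltnW jN)// [X in _ = X + _](_ : _ = 0) ?add0r; last first.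
    rewrite big_nat_cond big1// => m /andP[/andP[_ mj] _].
    by rewrite /E leqNgt mj mul0r.
  rewrite -[X in \sum_(X <= i < N) _]add0n big_addn big_mkord.
  by apply: eq_bigr => i _; rewrite hornerZ addnK.
have mjN : (m0 - j0 < N - j0)%N by rewrite ltn_sub2r.
by move=> /(_ mjN); rewrite subnK// /E jm inord_val => /eqP; rewrite subr_eq0 => /eqP.
Qed.

End Main.

Theorem proposition5p5 (R : realType) (alpha beta gamma delta : R)
    (eta : bool) (q : {poly R}) (a b c d : R)
    (ltab : alpha < beta) (ltgd : gamma < delta)
    (rho_gt0 : forall x, alpha < x < beta -> 0 < rho eta q x)
    (sym_gd : eta -> delta = - gamma /\ 0 < delta)
    (deg_q : (2 + eta <= (size q).-1)%N)
    (a_gt : -1 < a) (b_gt : -1 < b) (c_gt : -1 < c) (d_gt : -1 < d)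
    (eq_cd : eta -> c = d)
    (int_wR : weight_integrable alpha beta (wR alpha beta eta q a b (c + d + 1)))
    (int_wP : weight_integrable gamma delta (wP gamma delta d c)) :
  let d0 := (size q).-1%:Z in
  let deg2 := (size (rho2 eta q)).-1%:Z in
  let H1 := koornwinderz alpha beta eta q gamma delta
              (a + 1) (b + 1) (c + 1) (d + 1) in
  (forall (n k : nat) (x y : R), (k <= n)%N ->
     Omega alpha beta eta q gamma delta (x, y) -> 0 < rho eta q x ->
     is_derive x (1 : R)
       (fun x' : R => koornwinder alpha beta eta q gamma delta a b c d n k x' y)
       (\sum_(m <- zrange (n%:Z - deg2 - 1) (n%:Z - 1))
          cx0 alpha beta eta q gamma delta a b c d n k m * H1 m k%:Z x y
      + \sum_(m <- zrange (n%:Z - 3) (n%:Z + deg2 - 3))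
          cx2 alpha beta eta q gamma delta a b c d n k m * H1 m (k%:Z - 2) x y
      + (if eta then 0 else
         \sum_(m <- zrange (n%:Z - d0 - 2) (n%:Z + d0 - 2))
          cx1 alpha beta q gamma delta a b c d n k m * H1 m (k%:Z - 1) x y)))
  /\ (exists! D : bmx R, is_Dx alpha beta eta q gamma delta a b c d D)
  /\ (forall D : bmx R, is_Dx alpha beta eta q gamma delta a b c d D ->
        bmx_banded D (deg2 - 3) (deg2 + 1) /\
        forall m n : nat, mx_banded (D m n) 0 2).
Proof.
move=> d0 deg2 H1.
have DxP := Dx_matrixP ltab ltgd rho_gt0 sym_gd deg_q a_gt b_gt c_gt d_gt eq_cd
  int_wR int_wP.
split; [|split].
- move=> n k x y kn _ r0.
  have -> := cx_sum_zrange ltab ltgd rho_gt0 deg_q a_gt b_gt c_gt d_gt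
    int_wR int_wP x y kn (ltnSn _).
  exact: (derive_koornwinder_sum ltab ltgd rho_gt0 sym_gd deg_q a_gt b_gt c_gt d_gt
    eq_cd int_wR int_wP y kn (ltnSn _) r0).
- exists (Dx_matrix alpha beta gamma delta eta q a b c d); split=> [|D DP].
    exact: DxP.
  exact: (is_Dx_unique ltab ltgd rho_gt0 a_gt b_gt c_gt d_gt int_wR int_wP DxP DP).
move=> D DP.
rewrite (is_Dx_unique ltab ltgd rho_gt0 a_gt b_gt c_gt d_gt int_wR int_wP DP DxP).
have DB := Dx_matrix_banded ltab ltgd rho_gt0 deg_q a_gt b_gt c_gt d_gt int_wR int_wP.
split=> [m n out|m n j k out].
  by apply/matrixP => j k; rewrite [RHS]mxE DB ?out.
by rewrite DB// out orbT.
Qed.
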